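(* For every $t\ge 0$ and $r>0$, $$-\frac{\partial W}{\partial t}(t,r)=\mathcal J_0(t,r)+\mathcal J_0(-t,r),\qquad \frac{\partial W}{\partial r}(t,r)=\mathcal J_1(t,r)-\mathcal J_1(-t,r),$$ where, for $j\in\{0,1\}$, $s\in\mathbb R$ and $r>0$, $$\mathcal J_j(s,r)=\frac1{\sqrt{2\pi}}\int_0^\infty \frac{\exp\left(-(r-s+r\xi)^2/2\right)}{\sqrt{\xi(\xi+2)}}\,(r-s+r\xi)\,(1+\xi)^j\,d\xi .$$ That is, $p'=\mathcal J_0(t,r)+\mathcal J_0(-t,r)$ and $u_r'=\mathcal J_1(t,r)-\mathcal J_1(-t,r)$ are the pressure and radial velocity pulsations $p'=-\partial W/\partial t$, $u_r'=\partial W/\partial r$ corresponding to the wave potential $W$.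
   Context: $W=W(t,r)$, with $r=|\mathbf r|$, $\mathbf r\in\mathbb R^2$, denotes the wave potential: the radially symmetric classical solution of the two-dimensional wave equation in $\mathbb R^2$ for $t\geq 0$, which in the radial variable is the Cauchy problem $$\frac{\partial^2 W}{\partial t^2}-\frac1r\frac{\partial}{\partial r}\left(r\frac{\partial W}{\partial r}\right)=0,\quad t>0,\ r>0,\qquad W|_{t=0}=0,\quad \frac{\partial W}{\partial t}\Big|_{t=0}=-\exp\left(-\frac{r^2}{2}\right).$$ The pressure and velocity pulsations are $p'(t,\mathbf r)=-\frac{\partial W}{\partial t}(t,r)$ and $\mathbf u'(t,\mathbf r)=u_r'(t,r)\,\mathbf r/r$ with $u_r'(t,r)=\frac{\partial W}{\partial r}(t,r)$. *)

(* Defs.v *)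
From Stdlib Require Import Reals Lra.
From Coquelicot Require Import Coquelicot.
Open Scope R_scope.

(* Derivative of f at x relative to the set D: one-sided at an endpoint of D,
   and the usual [is_derive] at an interior point. *)
Definition is_derive_within (D : R -> Prop) (f : R -> R) (x l : R) : Prop :=
  filterdiff f (within D (locally x)) (fun h => scal h l).

(* A function of (t, x, y) is curried, u : R -> R -> R -> R; a set T of times
   stands for the space-time domain T x R^2. *)
Definition continuous_st (T : R -> Prop) (u : R -> R -> R -> R) : Prop :=
  continuous_on (fun p : R * (R * R) => T (fst p))
    (fun p : R * (R * R) => u (fst p) (fst (snd p)) (snd (snd p))).

(* u is of class C^1 on T x R^2, with partial derivatives ut, ux, uy. *)
Definition C1_st (T : R -> Prop) (u ut ux uy : R -> R -> R -> R) : Prop :=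
  (forall t x y, T t ->
     is_derive_within T (fun s => u s x y) t (ut t x y) /\
     is_derive (fun z => u t z y) x (ux t x y) /\
     is_derive (fun z => u t x z) y (uy t x y)) /\
  continuous_st T u /\ continuous_st T ut /\
  continuous_st T ux /\ continuous_st T uy.

(* u is a classical solution of u_tt = u_xx + u_yy on t >= 0 with u = g and
   u_t = h at t = 0: it is C^1 on [0, oo) x R^2 and C^2 on (0, oo) x R^2.
   Nothing is assumed about u at negative times. *)
Definition classical_wave_solution (g h : R -> R -> R) (u : R -> R -> R -> R)
  : Prop :=
  exists ut ux uy : R -> R -> R -> R,
    C1_st (fun t => 0 <= t) u ut ux uy /\
    (exists utt utx uty uxt uxx uxy uyt uyx uyy : R -> R -> R -> R,
       C1_st (fun t => 0 < t) ut utt utx uty /\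
       C1_st (fun t => 0 < t) ux uxt uxx uxy /\
       C1_st (fun t => 0 < t) uy uyt uyx uyy /\
       forall t x y, 0 < t -> utt t x y = uxx t x y + uyy t x y) /\
    (forall x y, u 0 x y = g x y) /\
    (forall x y, ut 0 x y = h x y).

(* W is a function of time and of the radius; its values at negative times and
   negative radii are irrelevant. *)
Definition wave_potential (W : R -> R -> R) : Prop :=
  classical_wave_solution
    (fun _ _ => 0)
    (fun x y => - exp (- (sqrt (x ^ 2 + y ^ 2)) ^ 2 / 2))
    (fun t x y => W t (sqrt (x ^ 2 + y ^ 2))).

Definition J_integrand (j : nat) (s r xi : R) : R :=
  exp (- (r - s + r * xi) ^ 2 / 2) / sqrt (xi * (xi + 2))
  * (r - s + r * xi) * (1 + xi) ^ j.

(* Improper at both ends: the integrand is singular at xi = 0. *)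
Definition J (j : nat) (s r : R) : R :=
  / sqrt (2 * PI)
  * RInt_gen (J_integrand j s r) (at_right 0) (Rbar_locally p_infty).

Lemma is_derive_within_open (D : R -> Prop) (f : R -> R) (x l : R) :
  locally x D -> is_derive_within D f x l -> is_derive f x l.
Proof.
intros HD [Hl Hd]; split; [exact Hl|].
intros z Hz.
assert (Hw : is_filter_lim (within D (locally x)) z).
{ intros P HP. specialize (Hz P HP). unfold within.
  now apply filter_imp with (2 := Hz). }
intros eps. specialize (Hd z Hw eps). unfold within in Hd.
generalize (filter_and _ _ HD Hd). apply filter_imp. intros y [H1 H2]. auto.
Qed.

(* In the radial variable, a wave potential solves
   W_tt - (1/r) (r W_r)_r = 0, W(0, .) = 0, W_t(0, .) = - exp (- r^2 / 2). *)
Lemma wave_potential_radial (W : R -> R -> R) :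
  wave_potential W ->
  exists Wt Wr : R -> R -> R,
    (forall t r, 0 <= t -> 0 < r ->
       is_derive_within (fun s => 0 <= s) (fun s => W s r) t (Wt t r) /\
       is_derive (fun q => W t q) r (Wr t r)) /\
    (forall t r, 0 < t -> 0 < r ->
       exists Wtt rWr_r : R,
         is_derive (fun s => Wt s r) t Wtt /\
         is_derive (fun q => q * Wr t q) r rWr_r /\
         Wtt - / r * rWr_r = 0) /\
    (forall r, 0 < r -> W 0 r = 0) /\
    (forall r, 0 < r -> Wt 0 r = - exp (- r ^ 2 / 2)).
Proof.
intros (ut & ux & uy & HC1 & HC2 & Hg & Hh).
destruct HC2 as (utt & utx & uty & uxt & uxx & uxy & uyt & uyx & uyy
  & Ht & Hx & Hy & Heq).
assert (S0 : forall r, 0 < r -> sqrt (r ^ 2 + 0 ^ 2) = r).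
{ intros r Hr. replace (r ^ 2 + 0 ^ 2) with (r ^ 2) by ring.
  apply sqrt_pow2; lra. }
assert (HWr : forall t r, 0 <= t -> 0 < r ->
  is_derive (fun q => W t q) r (ux t r 0)).
{ intros t r H0 Hr. destruct HC1 as [H _]. destruct (H t r 0 H0) as (_ & H2 & _).
  apply is_derive_ext_loc with (2 := H2).
  exists (mkposreal r Hr). intros z Hz. rewrite S0; [reflexivity|].
  apply Rabs_lt_between' in Hz. simpl in Hz. lra. }
exists (fun t r => ut t r 0), (fun t r => ux t r 0). split; [|split; [|split]].
- intros t r H0 Hr. split; [|now apply HWr].
  destruct HC1 as [H _]. destruct (H t r 0 H0) as (H1 & _ & _).
  rewrite S0 in H1 by exact Hr. exact H1.
- intros t r H0 Hr.
  exists (utt t r 0), (1 * ux t r 0 + r * uxx t r 0).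
  assert (Hop : locally t (fun s => 0 < s)).
  { exists (mkposreal t H0). intros z Hz.
    apply Rabs_lt_between' in Hz. simpl in Hz. lra. }
  split; [|split].
  + apply is_derive_within_open with (1 := Hop). now apply Ht.
  + apply (is_derive_mult (fun q => q) (fun q => ux t q 0) r 1 (uxx t r 0)).
    * apply @is_derive_id.
    * now apply Hx.
    * intros; apply Rmult_comm.
  + (* u_yy (t, r, 0) = W_r / r *)
    assert (Hq : forall y, uy t r y =
      ux t (sqrt (r ^ 2 + y ^ 2)) 0 * (y / sqrt (r ^ 2 + y ^ 2))).
    { intros y. assert (P : 0 < r ^ 2 + y ^ 2) by nra.
      destruct HC1 as [H _].
      destruct (H t r y (Rlt_le _ _ H0)) as (_ & _ & H3).
      apply is_derive_unique in H3. rewrite <- H3. apply is_derive_unique.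
      assert (Q := HWr t (sqrt (r ^ 2 + y ^ 2)) (Rlt_le _ _ H0)
        (sqrt_lt_R0 _ P)).
      assert (E : is_derive (fun z => sqrt (r ^ 2 + z ^ 2)) y
        (y / sqrt (r ^ 2 + y ^ 2))).
      { auto_derive; [simpl in P; lra|]. simpl. field.
        apply Rgt_not_eq, sqrt_lt_R0. simpl in P; lra. }
      rewrite Rmult_comm. exact (is_derive_comp (fun q => W t q)
        (fun z => sqrt (r ^ 2 + z ^ 2)) _ _ _ Q E). }
    assert (D2 : uyy t r 0 = ux t r 0 / r).
    { assert (H3 : is_derive (fun z => uy t r z) 0 (uyy t r 0)) by now apply Hy.
      apply is_derive_unique in H3. rewrite <- H3. apply is_derive_unique.
      assert (P : 0 < r ^ 2 + 0 ^ 2) by nra.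
      assert (E1 : is_derive (fun z => sqrt (r ^ 2 + z ^ 2)) 0 0).
      { auto_derive; [simpl in P; lra|]. simpl. field.
        apply Rgt_not_eq, sqrt_lt_R0. simpl in P; lra. }
      assert (E2 : is_derive (fun z => z / sqrt (r ^ 2 + z ^ 2)) 0
        (/ r)).
      { auto_derive.
        - split; [simpl in P; lra|]. split; [|exact I].
          apply Rgt_not_eq, sqrt_lt_R0. simpl in P; lra.
        - replace (r * (r * 1) + 0 * (0 * 1)) with (r ^ 2) by (simpl; ring).
          rewrite sqrt_pow2 by lra. field. lra. }
      assert (E3 : is_derive (fun q => ux t q 0) (sqrt (r ^ 2 + 0 ^ 2))
        (uxx t r 0)).
      { rewrite S0 by exact Hr. now apply Hx. }
      assert (E4 := is_derive_comp (fun q => ux t q 0)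
        (fun z => sqrt (r ^ 2 + z ^ 2)) 0 _ _ E3 E1).
      assert (E5 := is_derive_mult (fun z => ux t (sqrt (r ^ 2 + z ^ 2)) 0)
        (fun z => z / sqrt (r ^ 2 + z ^ 2)) 0 _ _ E4 E2 (fun a b => Rmult_comm a b)).
      apply is_derive_ext with (f := fun z =>
        mult (ux t (sqrt (r ^ 2 + z ^ 2)) 0) (z / sqrt (r ^ 2 + z ^ 2))).
      { intros z. now rewrite Hq. }
      match type of E5 with is_derive _ _ ?l => replace (ux t r 0 / r) with l end.
      { exact E5. }
      rewrite S0 by exact Hr. unfold plus, mult, scal; simpl.
      unfold mult; simpl. field. lra. }
    rewrite (Heq t r 0 H0), D2. field. lra.
- intros r Hr. specialize (Hg r 0). rewrite S0 in Hg by exact Hr. exact Hg.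
- intros r Hr. specialize (Hh r 0). rewrite S0 in Hh by exact Hr. exact Hh.
Qed.

(* Main.v *)
Require Import Defs.
From Stdlib Require Import Reals Lra Lia.
From Coquelicot Require Import Coquelicot.
Open Scope R_scope.

(** Substituting [1 + xi = cosh x], with [phi y = y exp (- y^2 / 2)], gives
    [J j s r = 1 / sqrt (2 pi) * T j phi s r] where
    [T j h s r = int_0^oo h (r cosh x - s) cosh^j x dx].  Each
    [exp (- (r cosh x - s)^2 / 2)] is a plane wave with an imaginary angle, so
    superposing them over [x] solves the radial wave equation for [r > 0].
    Concretely [dT_j h / ds = - T_j h'] and [dT_j h / dr = T_(j+1) h'], and one
    integration by parts ([T_phi_identity]) shows that the two claimed fields
    [p = - (J 0 t r + J 0 (-t) r)] and [q = J 1 t r - J 1 (-t) r] satisfy the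
    first-order system [p_t = q_r + q / r], [p_r = q_t] that [W_t] and [W_r]
    satisfy as well ([T_radial_pair], [wave_potential_pair]).  At [t = 0] the
    second field vanishes by oddness and the first is [- exp (- r^2 / 2)] by
    the substitution [v = r sinh x] and the Gaussian integral
    ([T0_phi_initial]).

    It remains to prove uniqueness ([radial_wave_uniqueness]).  For the
    difference [(P, Q)] of the two pairs, the energy
    [int_a^(R - t) (P^2 + Q^2) r dr] grows at most by the flux [2 a |P Q|]
    through the inner boundary [r = a]; the shrinking outer boundary only loses
    energy.  The axis [r = 0] is where the representation by [T] is delicate:
    both [T 0] and [T 1] are singular there.  However [T 0 phi] is
    [O (r^(-1/2))] ([T0_phi_bound]), and the singular part of [T 1 phi s r] is
    [exp (- (r - s)^2 / 2) / r] ([T1_phi_near_0]), which cancels up to a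
    bounded term between [s = t] and [s = - t] ([T1_phi_diff_bounded]).  So the
    flux tends to [0] with [a], the energy vanishes, and the fields agree. *)

(** * Integrals over the half line dominated by [exp (- x / 2)] *)

Notation is_half_integral f l :=
  (is_RInt_gen f (at_point 0) (Rbar_locally p_infty) l).
Notation half_integral f :=
  (RInt_gen f (at_point 0) (Rbar_locally p_infty)).

Lemma is_half_integral_lim (f : R -> R) (l : R) :
  (forall x, continuous f x) ->
  is_lim (RInt f 0) p_infty l -> is_half_integral f l.
Proof.
intros Hf Hl P HP.
specialize (Hl P HP).
apply Filter_prod with (fun x => x = 0) (fun b => P (RInt f 0 b)).
- reflexivity.
- exact Hl.
- intros a b -> Hb. exists (RInt f 0 b). split; [|exact Hb].
  apply (RInt_correct f 0 b), ex_RInt_continuous. intros; apply Hf.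
Qed.

Lemma is_RInt_exp_half (K a b : R) :
  is_RInt (fun x => K * exp (- x / 2)) a b
    (2 * K * exp (- a / 2) - 2 * K * exp (- b / 2)).
Proof.
replace (2 * K * exp (- a / 2) - 2 * K * exp (- b / 2)) with
  (minus (- (2 * K * exp (- b / 2))) (- (2 * K * exp (- a / 2))))
  by (unfold minus, plus, opp; simpl; ring).
apply (is_RInt_derive (V := R_CompleteNormedModule)
  (fun x => - (2 * K * exp (- x / 2)))).
- intros x _. auto_derive; [exact I|]. unfold Rdiv. field.
- intros x _. apply (ex_derive_continuous (V := R_NormedModule)).
  auto_derive; exact I.
Qed.

Lemma exp_half_small (K : R) (eps : posreal) :
  exists M, 0 <= M /\ forall x, M < x -> 2 * K * exp (- x / 2) < eps.
Proof.
destruct (Rle_dec K 0) as [HK|HK].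
- exists 0. split; [lra|]. intros x _.
  assert (H := exp_pos (- x / 2)). assert (H' := cond_pos eps). nra.
- apply Rnot_le_lt in HK. assert (He := cond_pos eps).
  exists (4 * K / eps). split.
  { apply Rdiv_le_0_compat; lra. }
  intros x Hx.
  assert (Hx0 : 0 < x).
  { apply Rlt_trans with (2 := Hx). apply Rdiv_lt_0_compat; lra. }
  assert (H1 : 1 + x / 2 <= exp (x / 2)) by apply exp_ineq1_le.
  replace (- x / 2) with (- (x / 2)) by field. rewrite exp_Ropp.
  apply Rmult_lt_reg_r with (exp (x / 2)); [apply exp_pos|].
  rewrite Rmult_assoc, Rinv_l by (apply Rgt_not_eq, exp_pos).
  apply Rmult_lt_compat_l with (r := eps) in Hx; [|exact He].
  replace (eps * (4 * K / eps)) with (4 * K) in Hx by (field; lra).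
  nra.
Qed.

Lemma RInt_exp_dominated (f : R -> R) (K a b : R) :
  (forall x, continuous f x) ->
  (forall x, 0 <= x -> Rabs (f x) <= K * exp (- x / 2)) ->
  0 <= a <= b ->
  Rabs (RInt f a b) <= 2 * K * exp (- a / 2) - 2 * K * exp (- b / 2).
Proof.
intros Hf HK Hab.
assert (Hx : ex_RInt f a b) by (apply @ex_RInt_continuous; intros; apply Hf).
apply (norm_RInt_le f (fun x => K * exp (- x / 2)) a b).
- apply Hab.
- intros x Hx'. apply HK. lra.
- now apply (RInt_correct (V := R_CompleteNormedModule)).
- apply is_RInt_exp_half.
Qed.

(** The partial integrals are Cauchy: the one over [[u, v]] is at most
    [2 K exp (- u / 2)]. *)
Lemma ex_half_integral (f : R -> R) (K : R) :
  (forall x, continuous f x) ->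
  (forall x, 0 <= x -> Rabs (f x) <= K * exp (- x / 2)) ->
  ex_RInt_gen f (at_point 0) (Rbar_locally p_infty).
Proof.
intros Hf HK.
assert (K0 : 0 <= K).
{ specialize (HK 0 (Rle_refl 0)). assert (H := Rabs_pos (f 0)).
  assert (H1 := exp_pos (- 0 / 2)). nra. }
assert (Hex : forall a b, ex_RInt f a b).
{ intros a b. apply @ex_RInt_continuous. intros; apply Hf. }
destruct (proj1 (filterlim_locally_cauchy (F := Rbar_locally p_infty)
  (U := R_CompleteNormedModule) (RInt f 0))) as [l Hl].
- intros eps. destruct (exp_half_small K eps) as (M & M0 & HM).
  exists (fun x => M < x). split; [exists M; auto|].
  assert (W : forall u v, M < u -> u <= v ->
    Rabs (RInt f 0 v - RInt f 0 u) < eps).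
  { intros u v Hu Huv.
    replace (RInt f 0 v - RInt f 0 u) with (RInt f u v).
    2:{ assert (E := RInt_Chasles f 0 u v (Hex _ _) (Hex _ _)).
        change (RInt f 0 u + RInt f u v = RInt f 0 v) in E. lra. }
    apply Rle_lt_trans with (1 := RInt_exp_dominated f K u v Hf HK
      (conj (Rle_trans _ _ _ M0 (Rlt_le _ _ Hu)) Huv)).
    specialize (HM u Hu). assert (H1 := exp_pos (- v / 2)). nra. }
  intros u v Hu Hv. change (Rabs (RInt f 0 v - RInt f 0 u) < eps).
  destruct (Rle_dec u v) as [Huv|Huv]; [now apply W|].
  rewrite Rabs_minus_sym. apply W; lra.
- exists l. now apply is_half_integral_lim.
Qed.

Lemma half_integral_correct (f : R -> R) (K : R) :
  (forall x, continuous f x) ->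
  (forall x, 0 <= x -> Rabs (f x) <= K * exp (- x / 2)) ->
  is_half_integral f (half_integral f).
Proof.
intros Hf HK. apply (RInt_gen_correct (V := R_CompleteNormedModule)).
now apply ex_half_integral with K.
Qed.

Lemma is_half_integral_exp (K : R) :
  is_half_integral (fun x => K * exp (- x / 2)) (2 * K).
Proof.
apply is_half_integral_lim.
- intros x. apply (ex_derive_continuous (V := R_NormedModule)).
  auto_derive; exact I.
- intros P [eps HP]. destruct (exp_half_small (Rabs K) eps) as (M & M0 & HM).
  exists M. intros x Hx. apply HP.
  change (Rabs (RInt (fun x => K * exp (- x / 2)) 0 x - 2 * K) < eps).
  rewrite (is_RInt_unique _ _ _ _ (is_RInt_exp_half K 0 x)).
  replace (- 0 / 2) with 0 by field. rewrite exp_0.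
  replace (2 * K * 1 - 2 * K * exp (- x / 2) - 2 * K) with
    (- (2 * K * exp (- x / 2))) by ring.
  rewrite Rabs_Ropp, !Rabs_mult, (Rabs_pos_eq 2), (Rabs_pos_eq (exp _)).
  + now apply HM.
  + apply Rlt_le, exp_pos.
  + lra.
Qed.

Lemma half_integral_bound (f : R -> R) (l K : R) :
  is_half_integral f l ->
  (forall x, 0 <= x -> Rabs (f x) <= K * exp (- x / 2)) ->
  Rabs l <= 2 * K.
Proof.
intros Hl HK.
apply (RInt_gen_norm (V := R_CompleteNormedModule) (Fa := at_point 0)
  (Fb := Rbar_locally p_infty)
  f (fun x => K * exp (- x / 2)) l (2 * K)).
- apply Filter_prod with (fun x => x = 0) (fun b => 0 < b).
  + reflexivity.
  + now exists 0.
  + intros a b -> Hb. simpl. lra.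
- apply Filter_prod with (fun x => x = 0) (fun b => 0 < b).
  + reflexivity.
  + now exists 0.
  + intros a b -> Hb x Hx. simpl in Hx. apply HK. lra.
- exact Hl.
- apply is_half_integral_exp.
Qed.

Lemma ex_derive_continuity_pt (f : R -> R) (x : R) :
  ex_derive f x -> continuity_pt f x.
Proof.
intros H. apply continuity_pt_filterlim.
now apply (ex_derive_continuous (V := R_NormedModule)).
Qed.

(** The mean value theorem applied to [f], then to [f1], which gives [M] in
    place of the sharp constant [M / 2]. *)
Lemma taylor_quadratic (f f1 f2 : R -> R) (x y M : R) :
  (forall z, is_derive f z (f1 z)) ->
  (forall z, is_derive f1 z (f2 z)) ->
  (forall z, Rmin x y <= z <= Rmax x y -> Rabs (f2 z) <= M) ->
  Rabs (f y - f x - (y - x) * f1 x) <= M * (y - x) ^ 2.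
Proof.
intros H1 H2 HM.
assert (C1 : forall z, continuity_pt f z).
{ intros z. apply ex_derive_continuity_pt. now exists (f1 z). }
assert (C2 : forall z, continuity_pt f1 z).
{ intros z. apply ex_derive_continuity_pt. now exists (f2 z). }
destruct (MVT_gen f x y f1) as (c & Hc & E); [auto|auto|].
destruct (MVT_gen f1 x c f2) as (d & Hd & E'); [auto|auto|].
replace (f y - f x - (y - x) * f1 x) with ((f1 c - f1 x) * (y - x))
  by (rewrite E; ring).
rewrite E'.
assert (Hcx : Rabs (c - x) <= Rabs (y - x)).
{ revert Hc. unfold Rmin, Rmax, Rabs.
  destruct (Rle_dec x y), (Rcase_abs (c - x)), (Rcase_abs (y - x)); lra. }
assert (HdM : Rabs (f2 d) <= M).
{ apply HM. revert Hc Hd. unfold Rmin, Rmax.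
  destruct (Rle_dec x y), (Rle_dec x c); lra. }
rewrite !Rabs_mult, Rmult_assoc.
rewrite <- (pow2_abs (y - x)).
assert (P0 := Rabs_pos (f2 d)). assert (P1 := Rabs_pos (c - x)).
apply Rmult_le_compat; [exact P0| |exact HdM|nra].
apply Rmult_le_pos; apply Rabs_pos.
Qed.

Lemma is_derive_quadratic (F : R -> R) (x l K : R) (delta : posreal) :
  (forall y, Rabs (y - x) < delta ->
     Rabs (F y - F x - (y - x) * l) <= K * (y - x) ^ 2) ->
  is_derive F x l.
Proof.
intros H. apply is_derive_Reals. intros eps He.
assert (Hd := cond_pos delta).
assert (Hm : 0 < Rmin delta (eps / (Rabs K + 1))).
{ apply Rmin_pos; [exact Hd|]. apply Rdiv_lt_0_compat; [exact He|].
  assert (H0 := Rabs_pos K). lra. }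
exists (mkposreal _ Hm). intros h Hh0 Hh. simpl in Hh.
assert (H1 := Rlt_le_trans _ _ _ Hh (Rmin_l _ _)).
assert (H2 := Rlt_le_trans _ _ _ Hh (Rmin_r _ _)).
specialize (H (x + h)).
replace (x + h - x) with h in H by ring. specialize (H H1).
replace ((F (x + h) - F x) / h - l) with ((F (x + h) - F x - h * l) / h)
  by (field; exact Hh0).
unfold Rdiv. rewrite Rabs_mult, Rabs_inv.
assert (Hp : 0 < Rabs h) by now apply Rabs_pos_lt.
apply Rmult_lt_reg_r with (Rabs h); [exact Hp|].
rewrite Rmult_assoc, Rinv_l, Rmult_1_r by lra.
apply Rle_lt_trans with (1 := H).
rewrite <- (pow2_abs h).
assert (HK := Rabs_pos K). assert (HK1 := Rle_abs K).
assert (H3 : (Rabs K + 1) * Rabs h < eps).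
{ apply Rmult_lt_compat_l with (r := Rabs K + 1) in H2; [|lra].
  replace ((Rabs K + 1) * (eps / (Rabs K + 1))) with eps in H2
    by (field; lra). exact H2. }
simpl. nra.
Qed.

(** Differentiation under the integral sign.  Two derivatives of the integrand
    are controlled instead of one: the pointwise Taylor remainder is then
    quadratic in [y - x] with an integrable coefficient, and integrating it
    gives the derivative without any exchange of limits. *)
Lemma is_derive_half_integral (f f1 f2 : R -> R -> R) (x K : R)
  (delta : posreal) :
  (forall y z, continuous (f y) z) ->
  (forall z, continuous (f1 x) z) ->
  (forall y z, is_derive (fun u => f u z) y (f1 y z)) ->
  (forall y z, is_derive (fun u => f1 u z) y (f2 y z)) ->
  (forall y z, Rabs (y - x) < delta -> 0 <= z ->
     Rabs (f y z) <= K * exp (- z / 2) /\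
     Rabs (f1 y z) <= K * exp (- z / 2) /\
     Rabs (f2 y z) <= K * exp (- z / 2)) ->
  is_derive (fun y => half_integral (f y)) x (half_integral (f1 x)).
Proof.
intros Cf Cf1 D1 D2 HK.
assert (Hx : Rabs (x - x) < delta).
{ rewrite Rminus_diag, Rabs_R0. apply cond_pos. }
apply is_derive_quadratic with (K := 2 * K) (delta := delta).
intros y Hy.
assert (Iy : is_half_integral (f y) (half_integral (f y))).
{ apply half_integral_correct with K; [apply Cf|]. intros z Hz; now apply HK. }
assert (Ix : is_half_integral (f x) (half_integral (f x))).
{ apply half_integral_correct with K; [apply Cf|]. intros z Hz; now apply HK. }
assert (I1 : is_half_integral (f1 x) (half_integral (f1 x))).
{ apply half_integral_correct with K; [apply Cf1|]. intros z Hz; now apply HK. }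
assert (Id := is_RInt_gen_minus _ _ _ _ (is_RInt_gen_minus _ _ _ _ Iy Ix)
  (is_RInt_gen_scal _ (y - x) _ I1)).
apply half_integral_bound with (K := K * (y - x) ^ 2) in Id.
- unfold minus, plus, opp, scal in Id; simpl in Id. unfold mult in Id; simpl in Id.
  replace (2 * K * (y - x) ^ 2) with (2 * (K * (y - x) ^ 2)) by ring.
  exact Id.
- intros z Hz.
  change (Rabs (f y z - f x z - (y - x) * f1 x z)
    <= K * (y - x) ^ 2 * exp (- z / 2)).
  replace (K * (y - x) ^ 2 * exp (- z / 2)) with
    (K * exp (- z / 2) * (y - x) ^ 2) by ring.
  apply (taylor_quadratic (fun u => f u z) (fun u => f1 u z)
    (fun u => f2 u z)); [auto|auto|].
  intros u Hu. apply HK; [|exact Hz].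
  apply Rle_lt_trans with (2 := Hy).
  revert Hu. unfold Rmin, Rmax, Rabs.
  destruct (Rle_dec x y), (Rcase_abs (u - x)), (Rcase_abs (y - x)); lra.
Qed.

(** * Integrals of rapidly decreasing profiles along [r cosh x - s] *)

Lemma exp_monotone (x y : R) : x <= y -> exp x <= exp y.
Proof.
intros [H | ->]; [|apply Rle_refl]. now apply Rlt_le, exp_increasing.
Qed.

Lemma exp_pow (x : R) (n : nat) : exp (INR n * x) = exp x ^ n.
Proof.
induction n as [|n IH].
- simpl. now rewrite Rmult_0_l, exp_0.
- rewrite S_INR, Rmult_plus_distr_r, Rmult_1_l, exp_plus, IH. simpl. ring.
Qed.

Lemma exp_le_cosh (x : R) : exp x <= 2 * cosh x.
Proof. unfold cosh. assert (H := exp_pos (- x)). lra. Qed.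

Lemma cosh_ge_1 (x : R) : 1 <= cosh x.
Proof.
unfold cosh. assert (H := exp_ineq1_le x). assert (H' := exp_ineq1_le (- x)).
lra.
Qed.

Lemma inv_cosh_le (x : R) : 0 <= x -> / cosh x <= 2 * exp (- x / 2).
Proof.
intros Hx. assert (H1 := exp_le_cosh x). assert (H2 := cosh_ge_1 x).
assert (E : exp (- x / 2) * exp x = exp (x / 2)).
{ rewrite <- exp_plus. f_equal. field. }
assert (H3 := exp_ineq1_le (x / 2)). assert (H4 := exp_pos (- x / 2)).
apply Rmult_le_reg_r with (cosh x); [lra|]. rewrite Rinv_l by lra.
nra.
Qed.

Definition rapid (h : R -> R) : Prop :=
  forall n : nat, exists C, forall x, (1 + Rabs x) ^ n * Rabs (h x) <= C.

(** From [1 + u / m <= exp (u / m)] with [m = n + 1] one gets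
    [(1 + u)^m <= m^m exp u], and [u - u^2 / 2 <= 1 / 2] absorbs [exp u]. *)
Lemma rapid_exp : rapid (fun x => exp (- x ^ 2 / 2)).
Proof.
intros n. exists (INR (S n) ^ S n * exp (1 / 2)). intros x.
assert (Hu := Rabs_pos x). set (u := Rabs x) in *.
rewrite (Rabs_pos_eq (exp _)) by apply Rlt_le, exp_pos.
rewrite <- pow2_abs. fold u.
assert (Hn : 1 <= INR (S n)) by (rewrite S_INR; assert (H := pos_INR n); lra).
assert (H1 : (1 + u) ^ S n <= INR (S n) ^ S n * exp u).
{ replace (exp u) with (exp (u / INR (S n)) ^ S n).
  2:{ rewrite <- exp_pow. f_equal. field. lra. }
  rewrite <- Rpow_mult_distr. apply pow_incr. split; [lra|].
  apply Rle_trans with (INR (S n) * (1 + u / INR (S n))).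
  - rewrite Rmult_plus_distr_l. replace (INR (S n) * (u / INR (S n))) with u
      by (field; lra). lra.
  - apply Rmult_le_compat_l; [lra|]. apply exp_ineq1_le. }
assert (H2 : (1 + u) ^ n <= (1 + u) ^ S n) by (apply Rle_pow; [lra|lia]).
apply Rle_trans with (INR (S n) ^ S n * exp u * exp (- u ^ 2 / 2)).
- apply Rmult_le_compat_r; [apply Rlt_le, exp_pos|lra].
- rewrite Rmult_assoc, <- exp_plus.
  apply Rmult_le_compat_l; [apply pow_le; lra|].
  apply exp_monotone. assert (H3 := pow2_ge_0 (u - 1)). simpl in *. lra.
Qed.

Lemma rapid_ext (h k : R -> R) : (forall x, h x = k x) -> rapid h -> rapid k.
Proof.
intros E H n. destruct (H n) as [C HC]. exists C. intros x. now rewrite <- E.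
Qed.

Lemma rapid_mult_id (h : R -> R) : rapid h -> rapid (fun x => x * h x).
Proof.
intros H n. destruct (H (S n)) as [C HC]. exists C. intros x.
apply Rle_trans with (2 := HC x). rewrite Rabs_mult. simpl.
assert (P1 : 0 <= (1 + Rabs x) ^ n) by (apply pow_le; assert (H0 := Rabs_pos x); lra).
assert (P2 := Rabs_pos (h x)). assert (P3 := Rmult_le_pos _ _ P1 P2). nra.
Qed.

Lemma rapid_comb (h k : R -> R) (a b : R) :
  rapid h -> rapid k -> rapid (fun x => a * h x + b * k x).
Proof.
intros H H' n. destruct (H n) as [C HC]. destruct (H' n) as [D HD].
exists (Rabs a * C + Rabs b * D). intros x.
apply Rle_trans with (Rabs a * ((1 + Rabs x) ^ n * Rabs (h x))
  + Rabs b * ((1 + Rabs x) ^ n * Rabs (k x))).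
- assert (P1 : 0 <= (1 + Rabs x) ^ n)
    by (apply pow_le; assert (H0 := Rabs_pos x); lra).
  apply Rle_trans with ((1 + Rabs x) ^ n * (Rabs (a * h x) + Rabs (b * k x))).
  + apply Rmult_le_compat_l; [exact P1|]. apply Rabs_triang.
  + rewrite !Rabs_mult. apply Req_le. ring.
- apply Rplus_le_compat; apply Rmult_le_compat_l; auto using Rabs_pos.
Qed.

(** Writing [y = r cosh x - s], one has
    [cosh x <= (1 + |y|) (1 + s0) / r0]; decay of [h] in [y] at order [j + 1]
    therefore pays for [cosh^j x] and for one further factor [1 / cosh x].  The
    bound is uniform in [s] and [r], as differentiation under the integral
    requires. *)
Lemma rapid_cosh (h : R -> R) (j : nat) (s0 r0 : R) :
  rapid h -> 0 <= s0 -> 0 < r0 ->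
  exists K, forall s r x, Rabs s <= s0 -> r0 <= r -> 0 <= x ->
    Rabs (h (r * cosh x - s) * cosh x ^ j) <= K * exp (- x / 2).
Proof.
intros H Hs0 Hr0. destruct (H (S j)) as [C HC].
set (B := (1 + s0) / r0).
assert (HB : 0 < B) by (apply Rdiv_lt_0_compat; lra).
exists (2 * (B ^ S j * C)). intros s r x Hs Hr Hx.
assert (Hc := cosh_ge_1 x). assert (Hi := inv_cosh_le x Hx).
set (y := r * cosh x - s). specialize (HC y).
assert (Hy : cosh x <= B * (1 + Rabs y)).
{ apply Rmult_le_reg_l with r0; [exact Hr0|].
  replace (r0 * (B * (1 + Rabs y))) with ((1 + s0) * (1 + Rabs y))
    by (unfold B; field; lra).
  apply Rle_trans with (r * cosh x); [nra|].
  replace (r * cosh x) with (y + s) by (unfold y; ring).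
  assert (H1 := Rle_abs y). assert (H2 := Rle_abs s).
  assert (H3 := Rabs_pos y). nra. }
(* One power more than the integrand has, to keep a factor [/ cosh x]. *)
assert (Hp : cosh x ^ S j <= B ^ S j * (1 + Rabs y) ^ S j).
{ rewrite <- Rpow_mult_distr. apply pow_incr. lra. }
assert (HB' : 0 < B ^ S j) by now apply pow_lt.
assert (Hh := Rabs_pos (h y)).
assert (M : Rabs (h y) * cosh x ^ S j <= B ^ S j * C).
{ apply Rle_trans with (B ^ S j * ((1 + Rabs y) ^ S j * Rabs (h y))).
  - rewrite <- Rmult_assoc, (Rmult_comm (Rabs (h y))).
    now apply Rmult_le_compat_r.
  - apply Rmult_le_compat_l; lra. }
assert (Hcj : 0 <= cosh x ^ S j) by (apply pow_le; lra).
rewrite Rabs_mult, (Rabs_pos_eq (cosh x ^ j)) by (apply pow_le; lra).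
replace (Rabs (h y) * cosh x ^ j) with
  (Rabs (h y) * cosh x ^ S j * / cosh x) by (simpl; field; lra).
replace (2 * (B ^ S j * C) * exp (- x / 2)) with
  (B ^ S j * C * (2 * exp (- x / 2))) by ring.
apply Rmult_le_compat; [nra| |exact M|exact Hi].
apply Rlt_le, Rinv_0_lt_compat; lra.
Qed.

(** With [h = phi] below this is [sqrt (2 pi) J j s r] after the substitution
    [1 + xi = cosh x].  Leaving [h] and [j] free makes the family stable under
    the partial derivatives in [s] and [r]. *)
Definition T (j : nat) (h : R -> R) (s r : R) : R :=
  half_integral (fun x => h (r * cosh x - s) * cosh x ^ j).

Lemma continuous_of_derive (f f1 : R -> R) :
  (forall x, is_derive f x (f1 x)) -> forall x, continuous f x.
Proof.
intros H x. apply (ex_derive_continuous (V := R_NormedModule)).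
now exists (f1 x).
Qed.

Lemma is_derive_sinh (x : R) : is_derive sinh x (cosh x).
Proof. apply is_derive_Reals, derivable_pt_lim_sinh. Qed.

Lemma continuous_T_integrand (h : R -> R) (j : nat) (s r x : R) :
  (forall y, continuous h y) ->
  continuous (fun x => h (r * cosh x - s) * cosh x ^ j) x.
Proof.
intros H.
apply (continuous_mult (K := R_AbsRing)).
- apply (continuous_comp (fun x => r * cosh x - s) h); [|apply H].
  apply (ex_derive_continuous (V := R_NormedModule)).
  unfold cosh. auto_derive; exact I.
- apply (ex_derive_continuous (V := R_NormedModule)).
  unfold cosh. auto_derive; exact I.
Qed.

Lemma T_correct (j : nat) (h : R -> R) (s r : R) :
  (forall y, continuous h y) -> rapid h -> 0 < r ->
  is_half_integral (fun x => h (r * cosh x - s) * cosh x ^ j) (T j h s r).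
Proof.
intros Hc Hh Hr.
destruct (rapid_cosh h j (Rabs s) r Hh (Rabs_pos s) Hr) as [K HK].
apply half_integral_correct with K.
- intros x. now apply continuous_T_integrand.
- intros x Hx. apply HK; [apply Rle_refl|apply Rle_refl|exact Hx].
Qed.

Lemma T_opp (j : nat) (h : R -> R) (s r : R) :
  (forall y, continuous h y) -> rapid h -> 0 < r ->
  half_integral (fun x => - h (r * cosh x - s) * cosh x ^ j) = - T j h s r.
Proof.
intros Hc Hh Hr. apply (is_RInt_gen_unique (V := R_CompleteNormedModule)).
apply is_RInt_gen_ext with (f := fun x =>
  opp (h (r * cosh x - s) * cosh x ^ j)).
- apply filter_forall. intros ab x _. unfold opp; simpl. ring.
- apply (is_RInt_gen_opp (V := R_NormedModule)). now apply T_correct.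
Qed.

Lemma T_bound (j : nat) (h : R -> R) (s0 r0 : R) :
  (forall y, continuous h y) -> rapid h -> 0 <= s0 -> 0 < r0 ->
  exists K, forall s r, Rabs s <= s0 -> r0 <= r -> Rabs (T j h s r) <= K.
Proof.
intros Hc Hh Hs Hr.
destruct (rapid_cosh h j s0 r0 Hh Hs Hr) as [K HK].
exists (2 * K). intros s r Hs1 Hr1.
apply half_integral_bound with (f := fun x => h (r * cosh x - s) * cosh x ^ j).
- apply T_correct; [exact Hc|exact Hh|lra].
- intros x Hx. now apply HK.
Qed.

(** The data on [h] that [is_derive_half_integral] needs to differentiate
    [T j h] once. *)
Record smooth_rapid (h h1 h2 : R -> R) : Prop := {
  sr_derive : forall x, is_derive h x (h1 x);
  sr_derive1 : forall x, is_derive h1 x (h2 x);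
  sr_cont2 : forall x, continuous h2 x;
  sr_rapid : rapid h;
  sr_rapid1 : rapid h1;
  sr_rapid2 : rapid h2
}.

Lemma is_derive_T_s (j : nat) (h h1 h2 : R -> R) (s r : R) :
  smooth_rapid h h1 h2 -> 0 < r ->
  is_derive (fun s => T j h s r) s (- T j h1 s r).
Proof.
intros [D1 D2 C2 R0 R1 R2] Hr.
assert (C0 := continuous_of_derive _ _ D1).
assert (C1 := continuous_of_derive _ _ D2).
assert (Hs : 0 <= Rabs s + 1) by (assert (H := Rabs_pos s); lra).
destruct (rapid_cosh h j (Rabs s + 1) r R0 Hs Hr) as [K0 H0].
destruct (rapid_cosh h1 j (Rabs s + 1) r R1 Hs Hr) as [K1 H1].
destruct (rapid_cosh h2 j (Rabs s + 1) r R2 Hs Hr) as [K2 H2].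
rewrite <- T_opp by assumption.
apply (is_derive_half_integral
  (fun s x => h (r * cosh x - s) * cosh x ^ j)
  (fun s x => - h1 (r * cosh x - s) * cosh x ^ j)
  (fun s x => h2 (r * cosh x - s) * cosh x ^ j)
  s (Rmax K0 (Rmax K1 K2)) (mkposreal 1 Rlt_0_1)).
- intros y z. now apply continuous_T_integrand.
- intros z. apply (continuous_T_integrand (fun y => - h1 y)).
  intros y. now apply (continuous_opp (V := R_NormedModule)).
- intros y z. auto_derive.
  + now exists (h1 (r * cosh z - y)).
  + rewrite (is_derive_unique (fun x => h x) _ _ (D1 _)). unfold Rminus. ring.
- intros y z. auto_derive.
  + now exists (h2 (r * cosh z - y)).
  + rewrite (is_derive_unique (fun x => h1 x) _ _ (D2 _)). unfold Rminus. ring.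
- intros y z Hy Hz. simpl in Hy.
  assert (Hy' : Rabs y <= Rabs s + 1).
  { replace y with (y - s + s) by ring.
    apply Rle_trans with (1 := Rabs_triang _ _). lra. }
  assert (He := exp_pos (- z / 2)).
  assert (M0 := Rmax_l K0 (Rmax K1 K2)). assert (M0' := Rmax_r K0 (Rmax K1 K2)).
  assert (M1 := Rmax_l K1 K2). assert (M2 := Rmax_r K1 K2).
  repeat split; eapply Rle_trans.
  + apply H0; [exact Hy'|apply Rle_refl|exact Hz].
  + nra.
  + rewrite Ropp_mult_distr_l_reverse, Rabs_Ropp.
    apply H1; [exact Hy'|apply Rle_refl|exact Hz].
  + nra.
  + apply H2; [exact Hy'|apply Rle_refl|exact Hz].
  + nra.
Qed.

Lemma is_derive_T_r (j : nat) (h h1 h2 : R -> R) (s r : R) :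
  smooth_rapid h h1 h2 -> 0 < r ->
  is_derive (fun r => T j h s r) r (T (S j) h1 s r).
Proof.
intros [D1 D2 C2 R0 R1 R2] Hr.
assert (C0 := continuous_of_derive _ _ D1).
assert (C1 := continuous_of_derive _ _ D2).
assert (Hr2 : 0 < r / 2) by lra.
destruct (rapid_cosh h j (Rabs s) (r / 2) R0 (Rabs_pos s) Hr2) as [K0 H0].
destruct (rapid_cosh h1 (S j) (Rabs s) (r / 2) R1 (Rabs_pos s) Hr2) as [K1 H1].
destruct (rapid_cosh h2 (S (S j)) (Rabs s) (r / 2) R2 (Rabs_pos s) Hr2)
  as [K2 H2].
apply (is_derive_half_integral
  (fun r x => h (r * cosh x - s) * cosh x ^ j)
  (fun r x => h1 (r * cosh x - s) * cosh x ^ S j)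
  (fun r x => h2 (r * cosh x - s) * cosh x ^ S (S j))
  r (Rmax K0 (Rmax K1 K2)) (mkposreal (r / 2) Hr2)).
- intros y z. now apply continuous_T_integrand.
- intros z. now apply continuous_T_integrand.
- intros y z. auto_derive.
  + now exists (h1 (y * cosh z - s)).
  + rewrite (is_derive_unique (fun x => h x) _ _ (D1 _)). unfold Rminus. simpl. ring.
- intros y z. auto_derive.
  + now exists (h2 (y * cosh z - s)).
  + rewrite (is_derive_unique (fun x => h1 x) _ _ (D2 _)). unfold Rminus. simpl. ring.
- intros y z Hy Hz. simpl in Hy. apply Rabs_lt_between' in Hy.
  assert (Hy' : r / 2 <= y) by lra.
  assert (He := exp_pos (- z / 2)).
  assert (M0 := Rmax_l K0 (Rmax K1 K2)). assert (M0' := Rmax_r K0 (Rmax K1 K2)).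
  assert (M1 := Rmax_l K1 K2). assert (M2 := Rmax_r K1 K2).
  repeat split; eapply Rle_trans.
  + apply H0; [apply Rle_refl|exact Hy'|exact Hz].
  + nra.
  + apply H1; [apply Rle_refl|exact Hy'|exact Hz].
  + nra.
  + apply H2; [apply Rle_refl|exact Hy'|exact Hz].
  + nra.
Qed.

Lemma increment_bound (f f1 : R -> R) (a b M : R) :
  (forall x, Rmin a b <= x <= Rmax a b ->
     is_derive f x (f1 x) /\ Rabs (f1 x) <= M) ->
  Rabs (f b - f a) <= M * Rabs (b - a).
Proof.
intros H. destruct (MVT_gen f a b f1) as (c & Hc & ->).
- intros x Hx. apply H. lra.
- intros x Hx. apply ex_derive_continuity_pt.
  exists (f1 x). now apply H.
- rewrite Rabs_mult. apply Rmult_le_compat_r; [apply Rabs_pos|]. now apply H.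
Qed.

(** Both partial derivatives are again of the form [T], hence locally bounded,
    so that [T j h] is locally Lipschitz. *)
Lemma continuity_2d_T (j : nat) (h h1 h2 : R -> R) (s r : R) :
  smooth_rapid h h1 h2 -> 0 < r -> continuity_2d_pt (T j h) s r.
Proof.
intros Hh Hr eps.
assert (C1 := continuous_of_derive _ _ (sr_derive1 _ _ _ Hh)).
assert (R1 := sr_rapid1 _ _ _ Hh).
assert (Hs : 0 <= Rabs s + 1) by (assert (H := Rabs_pos s); lra).
assert (Hr2 : 0 < r / 2) by lra.
destruct (T_bound j h1 (Rabs s + 1) (r / 2) C1 R1 Hs Hr2) as [K1 H1].
destruct (T_bound (S j) h1 (Rabs s + 1) (r / 2) C1 R1 Hs Hr2) as [K2 H2].
set (K := Rmax 1 (Rmax K1 K2)).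
assert (HK : 1 <= K) by apply Rmax_l.
assert (HK1 : K1 <= K).
{ apply Rle_trans with (1 := Rmax_l K1 K2), Rmax_r. }
assert (HK2 : K2 <= K).
{ apply Rle_trans with (1 := Rmax_r K1 K2), Rmax_r. }
assert (Hd : 0 < Rmin (Rmin 1 (r / 2)) (eps / (2 * K))).
{ assert (He := cond_pos eps).
  repeat apply Rmin_pos; try lra. apply Rdiv_lt_0_compat; lra. }
exists (mkposreal _ Hd). intros u v Hu Hv. simpl in Hu, Hv.
assert (Hu1 := Rlt_le_trans _ _ _ Hu (Rmin_l _ _)).
assert (Hu2 := Rlt_le_trans _ _ _ Hu (Rmin_r _ _)).
assert (Hu3 := Rlt_le_trans _ _ _ Hu1 (Rmin_l _ _)).
assert (Hv1 := Rlt_le_trans _ _ _ Hv (Rmin_l _ _)).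
assert (Hv2 := Rlt_le_trans _ _ _ Hv (Rmin_r _ _)).
assert (Hv3 := Rlt_le_trans _ _ _ Hv1 (Rmin_r _ _)).
apply Rabs_lt_between' in Hv3.
assert (Bu : forall x, Rmin s u <= x <= Rmax s u -> Rabs x <= Rabs s + 1).
{ intros x Hx. revert Hx Hu3. unfold Rmin, Rmax, Rabs.
  destruct (Rle_dec s u), (Rcase_abs x), (Rcase_abs s), (Rcase_abs (u - s)); lra. }
assert (E1 : Rabs (T j h u v - T j h s v) <= K * Rabs (u - s)).
{ apply (increment_bound (fun s => T j h s v) (fun s => - T j h1 s v)).
  intros x Hx. split.
  - apply is_derive_T_s with h2; [exact Hh|lra].
  - rewrite Rabs_Ropp. apply Rle_trans with (2 := HK1).
    apply H1; [now apply Bu|lra]. }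
assert (E2 : Rabs (T j h s v - T j h s r) <= K * Rabs (v - r)).
{ apply (increment_bound (fun r => T j h s r) (fun r => T (S j) h1 s r)).
  intros x Hx.
  assert (Hx' : r / 2 <= x).
  { revert Hx. unfold Rmin. destruct (Rle_dec r v); lra. }
  split.
  - apply is_derive_T_r with h2; [exact Hh|lra].
  - apply Rle_trans with (2 := HK2).
    apply H2; [lra|exact Hx']. }
replace (T j h u v - T j h s r) with
  ((T j h u v - T j h s v) + (T j h s v - T j h s r)) by ring.
apply Rle_lt_trans with (1 := Rabs_triang _ _).
apply (Rmult_lt_compat_l K) in Hu2; [|lra].
apply (Rmult_lt_compat_l K) in Hv2; [|lra].
replace (K * (eps / (2 * K))) with (eps / 2) in Hu2, Hv2 by (field; lra).
lra.
Qed.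

(** * The Gaussian profile and the integrals [J] *)

Lemma is_half_integral_is_lim (f : R -> R) (l : R) :
  is_half_integral f l -> is_lim (RInt f 0) p_infty l.
Proof.
intros H P HP. destruct (H P HP) as [Q1 Q2 H1 H2 H3].
generalize H2. apply (filter_imp (F := Rbar_locally p_infty)). intros b Hb.
destruct (H3 0 b H1 Hb) as (y & Hy & HPy). simpl in Hy.
now rewrite (is_RInt_unique _ _ _ _ Hy).
Qed.

Lemma is_half_integral_primitive (G f : R -> R) (l : R) :
  (forall x, is_derive G x (f x)) -> (forall x, continuous f x) ->
  is_lim G p_infty l -> is_half_integral f (l - G 0).
Proof.
intros HG Hf Hl. apply is_half_integral_lim; [exact Hf|].
apply is_lim_ext with (fun x => G x - G 0).
- intros x. symmetry. apply is_RInt_unique.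
  apply (is_RInt_derive (V := R_CompleteNormedModule) G f); auto.
- apply is_lim_minus with l (G 0); [exact Hl|apply is_lim_const|reflexivity].
Qed.

Lemma is_lim_exp_dominated (G : R -> R) (K : R) :
  (forall x, 0 <= x -> Rabs (G x) <= K * exp (- x / 2)) ->
  is_lim G p_infty 0.
Proof.
intros HK P [eps HP].
destruct (exp_half_small K eps) as (M & M0 & HM).
exists M. intros x Hx. apply HP. change (Rabs (G x - 0) < eps).
rewrite Rminus_0_r.
specialize (HM x Hx). specialize (HK x (Rle_trans _ _ _ M0 (Rlt_le _ _ Hx))).
assert (H0 := Rabs_pos (G x)). lra.
Qed.

Definition gauss (x : R) : R := exp (- x ^ 2 / 2).
Definition phi (x : R) : R := x * exp (- x ^ 2 / 2).
(** The successive derivatives of [phi], which is itself [- gauss']. *)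
Definition phi1 (x : R) : R := (1 - x ^ 2) * exp (- x ^ 2 / 2).
Definition phi2 (x : R) : R := (x ^ 3 - 3 * x) * exp (- x ^ 2 / 2).
Definition phi3 (x : R) : R := (- x ^ 4 + 6 * x ^ 2 - 3) * exp (- x ^ 2 / 2).

Lemma is_derive_gauss (x : R) : is_derive gauss x (- phi x).
Proof. unfold gauss, phi. auto_derive; [exact I|]. simpl. unfold Rdiv. field. Qed.

Lemma is_derive_phi (x : R) : is_derive phi x (phi1 x).
Proof. unfold phi, phi1. auto_derive; [exact I|]. simpl. unfold Rdiv. field. Qed.

Lemma is_derive_phi1 (x : R) : is_derive phi1 x (phi2 x).
Proof. unfold phi1, phi2. auto_derive; [exact I|]. simpl. unfold Rdiv. field. Qed.

Lemma is_derive_phi2 (x : R) : is_derive phi2 x (phi3 x).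
Proof. unfold phi2, phi3. auto_derive; [exact I|]. simpl. unfold Rdiv. field. Qed.

Lemma continuous_gauss (x : R) : continuous gauss x.
Proof. exact (continuous_of_derive _ _ is_derive_gauss x). Qed.

Lemma continuous_phi (x : R) : continuous phi x.
Proof. exact (continuous_of_derive _ _ is_derive_phi x). Qed.

Lemma continuous_phi1 (x : R) : continuous phi1 x.
Proof. exact (continuous_of_derive _ _ is_derive_phi1 x). Qed.

Lemma rapid_phi : rapid phi.
Proof. apply rapid_mult_id, rapid_exp. Qed.

Lemma rapid_phi1 : rapid phi1.
Proof.
apply rapid_ext with (fun x => 1 * gauss x + -1 * (x * phi x)).
- intros x. unfold gauss, phi, phi1. ring.
- apply rapid_comb; [apply rapid_exp|apply rapid_mult_id, rapid_phi].
Qed.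

Lemma rapid_phi2 : rapid phi2.
Proof.
apply rapid_ext with (fun x => -1 * (x * phi1 x) + -2 * phi x).
- intros x. unfold phi2, phi, phi1. ring.
- apply rapid_comb; [apply rapid_mult_id, rapid_phi1|apply rapid_phi].
Qed.

Lemma rapid_phi3 : rapid phi3.
Proof.
apply rapid_ext with (fun x => -1 * (x * phi2 x) + -3 * phi1 x).
- intros x. unfold phi3, phi2, phi1. ring.
- apply rapid_comb; [apply rapid_mult_id, rapid_phi2|apply rapid_phi1].
Qed.

Lemma smooth_rapid_phi : smooth_rapid phi phi1 phi2.
Proof.
constructor; auto using is_derive_phi, is_derive_phi1, rapid_phi, rapid_phi1,
  rapid_phi2.
exact (continuous_of_derive _ _ is_derive_phi2).
Qed.

Lemma smooth_rapid_phi1 : smooth_rapid phi1 phi2 phi3.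
Proof.
constructor; auto using is_derive_phi1, is_derive_phi2, rapid_phi1,
  rapid_phi2, rapid_phi3.
intros x. apply (ex_derive_continuous (V := R_NormedModule)).
unfold phi3. auto_derive; exact I.
Qed.

Lemma cosh2_sinh2 (x : R) : cosh x ^ 2 = 1 + sinh x ^ 2.
Proof.
unfold cosh, sinh.
assert (H : exp x * exp (- x) = 1).
{ rewrite <- exp_plus, Rplus_opp_r. apply exp_0. }
replace (((exp x + exp (- x)) / 2) ^ 2) with
  (((exp x - exp (- x)) / 2) ^ 2 + exp x * exp (- x)) by field.
rewrite H. ring.
Qed.

(** The inverse of [y |-> cosh y - 1] on the half line, from
    [sinh^2 y = cosh^2 y - 1 = x (x + 2)]. *)
Definition arcosh1p (x : R) : R := arcsinh (sqrt (x * (x + 2))).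

Lemma cosh_arcosh1p (x : R) : 0 <= x -> cosh (arcosh1p x) = 1 + x.
Proof.
intros Hx. assert (H := cosh_ge_1 (arcosh1p x)).
apply Rsqr_inj; [lra|lra|]. rewrite !Rsqr_pow2, cosh2_sinh2.
unfold arcosh1p. rewrite sinh_arcsinh, pow2_sqrt by nra. ring.
Qed.

Lemma is_derive_arcosh1p (x : R) :
  0 < x -> is_derive arcosh1p x (/ sqrt (x * (x + 2))).
Proof.
intros Hx. assert (Hp : 0 < x * (x + 2)) by nra.
assert (Hs := sqrt_lt_R0 _ Hp).
unfold arcosh1p.
replace (/ sqrt (x * (x + 2))) with
  (scal ((x + 1) / sqrt (x * (x + 2))) (/ (x + 1))).
2:{ unfold scal; simpl; unfold mult; simpl. field. lra. }
apply (is_derive_comp arcsinh (fun x => sqrt (x * (x + 2)))).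
- apply is_derive_Reals.
  replace (/ (x + 1)) with (/ sqrt (sqrt (x * (x + 2)) ^ 2 + 1)).
  + apply derivable_pt_lim_arcsinh.
  + rewrite pow2_sqrt by lra. f_equal.
    replace (x * (x + 2) + 1) with ((x + 1) ^ 2) by ring.
    apply sqrt_pow2. lra.
- auto_derive; [exact Hp|]. field. lra.
Qed.

Lemma arcosh1p_at_0 : filterlim arcosh1p (at_right 0) (locally 0).
Proof.
replace 0 with (arcosh1p 0) at 2.
2:{ unfold arcosh1p. rewrite Rmult_0_l, sqrt_0. apply arcsinh_0. }
eapply filterlim_filter_le_1; [apply (filter_le_within (F := locally 0))|].
apply (continuous_comp (fun x => sqrt (x * (x + 2))) arcsinh).
- apply (continuous_comp (fun x => x * (x + 2)) sqrt).
  + apply (ex_derive_continuous (V := R_NormedModule)). auto_derive; exact I.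
  + apply continuous_sqrt.
- apply (ex_derive_continuous (V := R_NormedModule)).
  eexists. apply is_derive_Reals. apply derivable_pt_lim_arcsinh.
Qed.

Lemma arcosh1p_at_infty :
  filterlim arcosh1p (Rbar_locally p_infty) (Rbar_locally p_infty).
Proof.
intros P [M HP]. exists (Rmax 0 (sinh M)). intros x Hx. apply HP.
assert (H0 := Rle_lt_trans _ _ _ (Rmax_l _ _) Hx).
assert (H1 := Rle_lt_trans _ _ _ (Rmax_r _ _) Hx).
rewrite <- (arcsinh_sinh M). apply arcsinh_lt.
apply Rlt_le_trans with (1 := H1).
rewrite <- (sqrt_pow2 x) at 1 by lra.
apply sqrt_le_1; nra.
Qed.

Lemma filterlim_minus_pair (a b : R) :
  filterlim (fun z : R * R => minus (fst z) (snd z))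
    (filter_prod (locally a) (locally b)) (locally (minus a b)).
Proof.
unfold minus.
apply (filterlim_comp_2 (G := locally a) (H := locally (opp b))
  fst (fun z => opp (snd z))).
- apply filterlim_fst.
- apply (filterlim_comp _ _ _ snd opp _ _ _ filterlim_snd).
  apply (filterlim_opp (V := R_NormedModule)).
- apply (filterlim_plus (V := R_NormedModule)).
Qed.

(** The weight [1 / sqrt (xi (xi + 2))] is exactly the derivative of
    [arcosh1p], so the change of variables removes the singularity at [0] and
    both improper endpoints are handled by limits of [arcosh1p]. *)
Lemma is_RInt_gen_J (j : nat) (s r : R) :
  0 < r ->
  is_RInt_gen (J_integrand j s r) (at_right 0) (Rbar_locally p_infty)
    (T j phi s r).
Proof.
intros Hr.
set (f := fun x => phi (r * cosh x - s) * cosh x ^ j).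
assert (Cf : forall x, continuous f x).
{ intros x. apply continuous_T_integrand, continuous_phi. }
assert (Ef : forall a b, ex_RInt f a b).
{ intros a b. apply @ex_RInt_continuous. auto. }
assert (L := is_half_integral_is_lim _ _
  (T_correct j phi s r continuous_phi rapid_phi Hr)).
fold f in L.
(* After the change of variables, the integral from [a] to [b] is a difference
   of two values of the primitive [RInt f 0]; [L0] is its limit at the lower
   end, [L] at the upper one. *)
assert (L0 : filterlim (RInt f 0) (locally 0) (locally 0)).
{ assert (C := continuous_RInt_1 f 0 0 (RInt f 0)).
  unfold continuous in C. rewrite RInt_point in C. apply C.
  apply filter_forall. intros z. now apply (RInt_correct f). }
assert (F : filterlim (fun ab => RInt f (arcosh1p (fst ab)) (arcosh1p (snd ab)))
  (filter_prod (at_right 0) (Rbar_locally p_infty))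
  (locally (T j phi s r))).
{ apply filterlim_ext with (fun ab =>
    minus (RInt f 0 (arcosh1p (snd ab))) (RInt f 0 (arcosh1p (fst ab)))).
  { intros [a b]. simpl.
    assert (E := RInt_Chasles f 0 (arcosh1p a) (arcosh1p b) (Ef _ _) (Ef _ _)).
    rewrite <- E. unfold minus. rewrite plus_comm, plus_assoc, plus_opp_l.
    apply plus_zero_l. }
  replace (T j phi s r) with (minus (T j phi s r) 0)
    by (unfold minus, plus, opp; simpl; ring).
  apply (filterlim_comp_2 (H := locally 0) (G := locally (T j phi s r))
    (fun ab => RInt f 0 (arcosh1p (snd ab)))
    (fun ab => RInt f 0 (arcosh1p (fst ab)))).
  - apply (filterlim_comp _ _ _ snd (fun b => RInt f 0 (arcosh1p b)) _ _ _
      filterlim_snd).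
    exact (filterlim_comp _ _ _ arcosh1p (RInt f 0) _ _ _
      arcosh1p_at_infty L).
  - apply (filterlim_comp _ _ _ fst (fun a => RInt f 0 (arcosh1p a)) _ _ _
      filterlim_fst).
    exact (filterlim_comp _ _ _ arcosh1p (RInt f 0) _ _ _ arcosh1p_at_0 L0).
  - apply (filterlim_minus_pair (T j phi s r) 0). }
intros P HP. specialize (F P HP). unfold filtermap in F.
assert (Pos : filter_prod (at_right 0) (Rbar_locally p_infty)
  (fun ab => 0 < fst ab /\ 0 < snd ab)).
{ apply Filter_prod with (fun x => 0 < x) (fun x => 0 < x).
  - exists (mkposreal 1 Rlt_0_1). auto.
  - now exists 0.
  - auto. }
generalize (filter_and _ _ F Pos).
apply (filter_imp (F := filter_prod (at_right 0) (Rbar_locally p_infty))).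
intros [a b] [HPab [Ha Hb]]. simpl in *.
exists (RInt f (arcosh1p a) (arcosh1p b)). split; [|exact HPab].
assert (Hab : forall x, Rmin a b <= x <= Rmax a b -> 0 < x).
{ intros x. unfold Rmin, Rmax. destruct (Rle_dec a b); lra. }
apply is_RInt_ext with (fun x =>
  scal (/ sqrt (x * (x + 2))) (f (arcosh1p x))).
- intros x Hx. assert (Hx0 : 0 < x) by (apply Hab; lra).
  unfold f, J_integrand, phi, scal; simpl; unfold mult; simpl.
  rewrite cosh_arcosh1p by lra.
  replace (r * (1 + x) - s) with (r - s + r * x) by ring.
  unfold Rdiv. ring.
- apply (is_RInt_comp (V := R_CompleteNormedModule) f arcosh1p).
  + auto.
  + intros x Hx. split.
    * apply is_derive_arcosh1p. auto.
    * specialize (Hab x Hx). assert (Hp : 0 < x * (x + 2)) by nra.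
      assert (Hs := sqrt_lt_R0 _ Hp).
      apply (ex_derive_continuous (V := R_NormedModule)).
      auto_derive. repeat split; lra.
Qed.

Lemma J_eq (j : nat) (s r : R) :
  0 < r -> J j s r = / sqrt (2 * PI) * T j phi s r.
Proof.
intros Hr. unfold J. f_equal.
apply (is_RInt_gen_unique (V := R_CompleteNormedModule)).
now apply is_RInt_gen_J.
Qed.

(** * Identities and bounds for [T] *)

(** The integrand of the left-hand side is the derivative of
    [phi (r cosh x - s) sinh x], which vanishes at both ends.  This is the wave
    equation for the plane-wave superposition. *)
Lemma T_phi_identity (s r : R) :
  0 < r ->
  r * (T 2 phi1 s r - T 0 phi1 s r) + T 1 phi s r = 0.
Proof.
intros Hr.
assert (I2 := T_correct 2 phi1 s r continuous_phi1 rapid_phi1 Hr).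
assert (I0 := T_correct 0 phi1 s r continuous_phi1 rapid_phi1 Hr).
assert (I1 := T_correct 1 phi s r continuous_phi rapid_phi Hr).
assert (I := is_RInt_gen_plus _ _ _ _
  (is_RInt_gen_scal _ r _ (is_RInt_gen_minus _ _ _ _ I2 I0)) I1).
refine (eq_trans (eq_sym
  (is_RInt_gen_unique (V := R_CompleteNormedModule) _ _ I)) _).
transitivity (0 - phi (r * cosh 0 - s) * sinh 0);
  [|rewrite sinh_0, Rmult_0_r; apply Rminus_0_r].
apply (is_RInt_gen_unique (V := R_CompleteNormedModule)).
apply (is_half_integral_primitive (fun x => phi (r * cosh x - s) * sinh x)).
- intros x.
  replace (plus _ _) with
    (phi1 (r * cosh x - s) * (r * sinh x) * sinh x +
     phi (r * cosh x - s) * cosh x).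
  2:{ unfold plus, scal, minus, opp; simpl. unfold plus, mult; simpl.
      assert (H := cosh2_sinh2 x). simpl in H.
      replace (cosh x * (cosh x * 1)) with (1 + sinh x * (sinh x * 1)).
      ring. }
  auto_derive.
  + eexists; apply is_derive_phi.
  + rewrite (is_derive_unique (fun x => phi x) _ _ (is_derive_phi _)).
    unfold Rminus. ring.
- intros x.
  apply (continuous_plus (V := R_NormedModule)).
  + apply (continuous_scal_r (V := R_NormedModule)).
    apply (continuous_minus (V := R_NormedModule));
      apply continuous_T_integrand, continuous_phi1.
  + apply continuous_T_integrand, continuous_phi.
- destruct (rapid_cosh phi 1 (Rabs s) r rapid_phi (Rabs_pos s) Hr) as [K HK].
  apply is_lim_exp_dominated with K. intros x Hx.
  apply Rle_trans with (2 := HK s r x (Rle_refl _) (Rle_refl _) Hx).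
  rewrite !Rabs_mult. apply Rmult_le_compat_l; [apply Rabs_pos|].
  rewrite pow_1. apply Rsqr_le_abs_0. rewrite !Rsqr_pow2, cosh2_sinh2. lra.
Qed.

(** Two bounds on [phi y] with [y = r cosh x - s] are available: a constant,
    and a constant over [1 + |y|], that is over [r cosh x].  Neither suffices
    (the first is not integrable in [x], the second costs a factor [1 / r]);
    their geometric mean gives [1 / sqrt (r cosh x)], which is integrable. *)
Lemma T0_phi_bound (s0 : R) :
  0 <= s0 ->
  exists B, 0 <= B /\ forall s r, Rabs s <= s0 -> 0 < r ->
    Rabs (T 0 phi s r) <= sqrt (B / r).
Proof.
intros Hs0. destruct (rapid_phi 1%nat) as [C HC].
exists (8 * (C ^ 2 * (1 + s0))). split.
{ assert (H := pow2_ge_0 C). nra. }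
intros s r Hs Hr.
set (A := C ^ 2 * (1 + s0)).
assert (HA : 0 <= A) by (assert (H := pow2_ge_0 C); unfold A; nra).
(* The dominating function [sqrt (2 A / r) exp (- x / 2)] has integral twice
   its coefficient. *)
replace (sqrt (8 * A / r)) with (2 * sqrt (2 * A / r)).
2:{ replace (8 * A / r) with (2 ^ 2 * (2 * A / r)) by (field; lra).
    rewrite sqrt_mult_alt, sqrt_pow2 by lra. reflexivity. }
apply half_integral_bound with (1 := T_correct 0 phi s r continuous_phi
  rapid_phi Hr).
intros x Hx. rewrite pow_O, Rmult_1_r.
set (y := r * cosh x - s). specialize (HC y). rewrite pow_1 in HC.
assert (Hy := Rabs_pos y). assert (Hp := Rabs_pos (phi y)).
replace (- x / 2) with (- (x / 2)) by field. rewrite exp_Ropp.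
assert (He := exp_pos (x / 2)).
apply Rmult_le_reg_r with (exp (x / 2)); [exact He|].
rewrite Rmult_assoc, Rinv_l, Rmult_1_r by lra.
rewrite <- (sqrt_pow2 (Rabs (phi y) * exp (x / 2))) by nra.
apply sqrt_le_1_alt.
apply Rmult_le_reg_r with r; [exact Hr|].
replace (2 * A / r * r) with (2 * A) by (field; lra).
assert (E : exp (x / 2) ^ 2 <= 2 * cosh x).
{ simpl. rewrite Rmult_1_r, <- exp_plus.
  replace (x / 2 + x / 2) with x by field. apply exp_le_cosh. }
assert (Hc : r * cosh x <= (1 + s0) * (1 + Rabs y)).
{ replace (r * cosh x) with (y + s) by (unfold y; ring).
  assert (H1 := Rle_abs y). assert (H2 := Rle_abs s). nra. }
set (p := Rabs (phi y)) in *. set (e := exp (x / 2)) in *.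
assert (H1 : p <= C) by nra.
assert (H2 : p ^ 2 * (1 + Rabs y) <= C ^ 2).
{ replace (p ^ 2 * (1 + Rabs y)) with (p * ((1 + Rabs y) * p)) by ring.
  simpl. rewrite Rmult_1_r. apply Rmult_le_compat; nra. }
replace ((p * e) ^ 2 * r) with (p ^ 2 * r * e ^ 2) by ring.
assert (P2 := pow2_ge_0 p).
apply Rle_trans with (p ^ 2 * r * (2 * cosh x)).
{ apply Rmult_le_compat_l; [nra|exact E]. }
replace (p ^ 2 * r * (2 * cosh x)) with (2 * (p ^ 2 * (r * cosh x))) by ring.
apply Rmult_le_compat_l; [lra|]. unfold A.
apply Rle_trans with (p ^ 2 * ((1 + s0) * (1 + Rabs y))).
{ now apply Rmult_le_compat_l. }
nra.
Qed.

Lemma phi_bounded : exists C, forall x, Rabs (phi x) <= C.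
Proof.
destruct (rapid_phi 0%nat) as [C HC]. exists C. intros x.
specialize (HC x). simpl in HC. lra.
Qed.

(** Since [cosh x = sinh x + exp (- x)], the part with [sinh x] integrates
    exactly to the singular term and the rest is bounded uniformly in [r]. *)
Lemma T1_phi_near_0 :
  exists K, forall s r, 0 < r -> Rabs (T 1 phi s r - gauss (r - s) / r) <= K.
Proof.
destruct phi_bounded as [C HC]. exists (2 * C). intros s r Hr.
assert (I1 := T_correct 1 phi s r continuous_phi rapid_phi Hr).
assert (Cs : forall x, continuous sinh x)
  by exact (continuous_of_derive _ _ is_derive_sinh).
assert (I2 : is_half_integral (fun x => phi (r * cosh x - s) * sinh x)
  (gauss (r - s) / r)).
{ replace (gauss (r - s) / r) with (0 - - / r * gauss (r * cosh 0 - s)).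
  2:{ rewrite cosh_0. unfold Rdiv. rewrite Rmult_1_r. ring. }
  apply (is_half_integral_primitive (fun x => - / r * gauss (r * cosh x - s))).
  - intros x. auto_derive.
    + eexists; apply is_derive_gauss.
    + rewrite (is_derive_unique (fun x => gauss x) _ _ (is_derive_gauss _)).
      unfold Rminus. field. lra.
  - intros x. apply (continuous_mult (K := R_AbsRing)); [|apply Cs].
    apply (continuous_comp (fun x => r * cosh x - s) phi);
      [|apply continuous_phi].
    apply (ex_derive_continuous (V := R_NormedModule)).
    unfold cosh. auto_derive; exact I.
  - replace (Finite 0) with (Rbar_mult (- / r) 0)
      by (simpl; now rewrite Rmult_0_r).
    apply is_lim_scal_l.
    destruct (rapid_cosh gauss 0 (Rabs s) r rapid_exp (Rabs_pos s) Hr)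
      as [K HK].
    apply is_lim_exp_dominated with K. intros x Hx.
    specialize (HK s r x (Rle_refl _) (Rle_refl _) Hx).
    now rewrite pow_O, Rmult_1_r in HK. }
assert (I := is_RInt_gen_minus _ _ _ _ I1 I2).
apply half_integral_bound with (1 := I). intros x Hx.
change (Rabs (phi (r * cosh x - s) * cosh x ^ 1 -
  phi (r * cosh x - s) * sinh x) <= C * exp (- x / 2)).
rewrite pow_1, <- Rmult_minus_distr_l, Rabs_mult.
apply Rmult_le_compat; [apply Rabs_pos|apply Rabs_pos|apply HC|].
replace (cosh x - sinh x) with (exp (- x)) by (unfold cosh, sinh; field).
rewrite Rabs_pos_eq by apply Rlt_le, exp_pos.
apply exp_monotone. lra.
Qed.

(** The singular terms at [s] and [- s] cancel because [gauss] is even and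
    Lipschitz: [|gauss (s - r) - gauss (s + r)| <= 2 C r]. *)
Lemma T1_phi_diff_bounded :
  exists K, forall s r, 0 < r -> Rabs (T 1 phi s r - T 1 phi (- s) r) <= K.
Proof.
destruct T1_phi_near_0 as [K HK]. destruct phi_bounded as [C HC].
exists (2 * K + 2 * C). intros s r Hr.
assert (H1 := HK s r Hr). assert (H2 := HK (- s) r Hr).
assert (H3 : Rabs (gauss (r - s) / r - gauss (r - - s) / r) <= 2 * C).
{ replace (gauss (r - s)) with (gauss (s - r)).
  2:{ unfold gauss. do 2 f_equal. ring. }
  replace (r - - s) with (s + r) by ring.
  replace (gauss (s - r) / r - gauss (s + r) / r) with
    ((gauss (s - r) - gauss (s + r)) / r) by (field; lra).
  unfold Rdiv. rewrite Rabs_mult, Rabs_inv, (Rabs_pos_eq r) by lra.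
  apply Rmult_le_reg_r with r; [exact Hr|].
  rewrite Rmult_assoc, Rinv_l, Rmult_1_r by lra.
  replace (2 * C * r) with (C * Rabs (s - r - (s + r))).
  2:{ replace (s - r - (s + r)) with (- (2 * r)) by ring.
      rewrite Rabs_Ropp, Rabs_pos_eq by lra. ring. }
  apply increment_bound with (fun x => - phi x). intros x _. split.
  - apply is_derive_gauss.
  - now rewrite Rabs_Ropp. }
(* The two singular terms are subtracted and added back together. *)
replace (T 1 phi s r - T 1 phi (- s) r) with
  ((T 1 phi s r - gauss (r - s) / r) +
   (- (T 1 phi (- s) r - gauss (r - - s) / r) +
    (gauss (r - s) / r - gauss (r - - s) / r))) by ring.
apply Rle_trans with (1 := Rabs_triang _ _).
assert (H4 := Rabs_triang (- (T 1 phi (- s) r - gauss (r - - s) / r))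
  (gauss (r - s) / r - gauss (r - - s) / r)).
rewrite Rabs_Ropp in H4. lra.
Qed.

(** The classical computation of the Gaussian integral: the two summands have
    opposite derivatives in [x], and at [x = 0] the second one is
    [2 atan 1]. *)
Lemma gauss_square_const (x : R) :
  RInt gauss 0 x ^ 2 +
  2 * RInt (fun t => exp (- (x ^ 2 * (1 + t ^ 2)) / 2) / (1 + t ^ 2)) 0 1
  = PI / 2.
Proof.
set (k := fun x t => exp (- (x ^ 2 * (1 + t ^ 2)) / 2) / (1 + t ^ 2)).
assert (Dk : forall t x, is_derive (fun x => k x t) x
  (- x * exp (- (x ^ 2 * (1 + t ^ 2)) / 2))).
{ intros t y. unfold k. assert (Ht : 0 <= t * t) by nra. auto_derive.
  - repeat split; simpl; nra.
  - simpl. unfold Rdiv. field. nra. }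
assert (Eg : forall a b, ex_RInt gauss a b).
{ intros a b. apply @ex_RInt_continuous. intros; apply continuous_gauss. }
assert (Ek : forall x, ex_RInt (k x) 0 1).
{ intros y. apply @ex_RInt_continuous. intros t _. unfold k.
  apply (ex_derive_continuous (V := R_NormedModule)).
  assert (Ht : 0 <= t * t) by nra. auto_derive. repeat split; simpl; nra. }
assert (DI : forall x, is_derive (fun x => RInt (k x) 0 1) x
  (- gauss x * RInt gauss 0 x)).
{ intros y.
  replace (- gauss y * RInt gauss 0 y) with
    (RInt (fun t => Derive (fun u => k u t) y) 0 1).
  - apply is_derive_RInt_param.
    + apply filter_forall. intros z t _. eexists. apply Dk.
    + intros t _.
      apply continuity_2d_pt_ext with
        (fun u v => - u * exp (- (u ^ 2 * (1 + v ^ 2)) / 2)).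
      { intros u v. symmetry. apply is_derive_unique, Dk. }
      apply continuity_2d_pt_mult.
      { apply continuity_2d_pt_opp, continuity_2d_pt_id1. }
      apply (continuity_1d_2d_pt_comp exp
        (fun u v => - (u ^ 2 * (1 + v ^ 2)) / 2)).
      { apply derivable_continuous_pt, derivable_pt_exp. }
      apply (continuity_1d_2d_pt_comp (fun z => - z / 2)
        (fun u v => u ^ 2 * (1 + v ^ 2))).
      { apply ex_derive_continuity_pt. auto_derive; exact I. }
      apply continuity_2d_pt_mult.
      * apply (continuity_1d_2d_pt_comp (fun z => z ^ 2) (fun u v => u)).
        { apply ex_derive_continuity_pt. auto_derive; exact I. }
        apply continuity_2d_pt_id1.
      * apply (continuity_1d_2d_pt_comp (fun z => 1 + z ^ 2) (fun u v => v)).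
        { apply ex_derive_continuity_pt. auto_derive; exact I. }
        apply continuity_2d_pt_id2.
    + apply filter_forall. intros z. apply Ek.
  - rewrite (RInt_ext _ (fun t => scal (- gauss y) (scal y (gauss (y * t + 0))))).
    2:{ intros t _. refine (eq_trans (is_derive_unique _ _ _ (Dk t y)) _).
        unfold scal; simpl; unfold mult; simpl. unfold gauss.
        replace (- (y * (y * 1) * (1 + t * (t * 1))) / 2) with
          (- y ^ 2 / 2 + - (y * t + 0) ^ 2 / 2) by field.
        rewrite exp_plus. ring. }
    rewrite (RInt_scal (V := R_CompleteNormedModule)).
    + rewrite (RInt_comp_lin gauss).
      * unfold scal; simpl; unfold mult; simpl.
        now rewrite Rmult_0_r, Rplus_0_l, Rmult_1_r, Rplus_0_r.
      * apply Eg.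
    + apply @ex_RInt_continuous. intros t _.
      apply (ex_derive_continuous (V := R_NormedModule)).
      unfold gauss, scal; simpl; unfold mult; simpl. auto_derive; exact I. }
set (F := fun x => RInt gauss 0 x ^ 2 + 2 * RInt (k x) 0 1).
assert (DF : forall x, is_derive F x 0).
{ intros y.
  assert (D1 : is_derive (RInt gauss 0) y (gauss y)).
  { apply (is_derive_RInt gauss (RInt gauss 0) 0 y).
    - apply filter_forall. intros z. now apply (RInt_correct gauss).
    - apply continuous_gauss. }
  assert (D2 : is_derive (fun z => z ^ 2) (RInt gauss 0 y)
    (2 * RInt gauss 0 y)).
  { auto_derive; [exact I|]. ring. }
  assert (D := is_derive_plus (V := R_NormedModule) _ _ _ _ _
    (is_derive_comp (fun z => z ^ 2) (RInt gauss 0) _ _ _ D2 D1)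
    (is_derive_scal _ _ 2 _ (DI y))).
  replace 0 with (plus (scal (gauss y) (2 * RInt gauss 0 y))
    (2 * (- gauss y * RInt gauss 0 y))); [exact D|].
  unfold plus, scal; simpl; unfold mult; simpl. ring. }
change (F x = PI / 2).
replace (PI / 2) with (F 0).
- destruct (MVT_gen F 0 x (fun _ => 0)) as (c & _ & E).
  + auto.
  + intros z _. apply ex_derive_continuity_pt. now exists 0.
  + lra.
- unfold F. rewrite RInt_point.
  assert (A : is_RInt (k 0) 0 1 (minus (atan 1) (atan 0))).
  { apply (is_RInt_derive (V := R_CompleteNormedModule) atan).
    - intros t _. assert (Ht : 0 <= t * t) by nra.
      replace (k 0 t) with (/ (1 + t ^ 2)).
      + apply is_derive_Reals.
        apply derivable_pt_lim_atan.
      + unfold k. replace (- (0 ^ 2 * (1 + t ^ 2)) / 2) with 0 by field.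
        rewrite exp_0. simpl. field. nra.
    - intros t _. assert (Ht : 0 <= t * t) by nra. unfold k.
      apply (ex_derive_continuous (V := R_NormedModule)).
      auto_derive. repeat split; simpl; nra. }
  rewrite (is_RInt_unique _ _ _ _ A), atan_1, atan_0.
  unfold minus, plus, opp, zero; simpl. field.
Qed.

Lemma gauss_integral : is_lim (RInt gauss 0) p_infty (sqrt (PI / 2)).
Proof.
set (k := fun x t => exp (- (x ^ 2 * (1 + t ^ 2)) / 2) / (1 + t ^ 2)).
assert (L : is_lim (fun x => RInt (k x) 0 1) p_infty 0).
{ apply is_lim_exp_dominated with (exp (1 / 2)). intros x Hx.
  replace (exp (1 / 2) * exp (- x / 2)) with
    ((1 - 0) * exp (1 / 2 - x / 2)).
  2:{ rewrite <- exp_plus, Rminus_0_r, Rmult_1_l. f_equal. field. }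
  apply abs_RInt_le_const.
  - lra.
  - apply @ex_RInt_continuous. intros t _. unfold k.
    apply (ex_derive_continuous (V := R_NormedModule)).
    assert (Ht : 0 <= t * t) by nra. auto_derive. repeat split; simpl; nra.
  - intros t Ht. unfold k.
    assert (Ht2 : 1 <= 1 + t ^ 2) by nra.
    rewrite Rabs_pos_eq.
    2:{ apply Rdiv_le_0_compat; [apply Rlt_le, exp_pos|lra]. }
    apply Rle_trans with (exp (- (x ^ 2 * (1 + t ^ 2)) / 2)).
    + apply Rmult_le_reg_r with (1 + t ^ 2); [lra|].
      unfold Rdiv at 1. rewrite Rmult_assoc, Rinv_l, Rmult_1_r by lra.
      assert (He := exp_pos (- (x ^ 2 * (1 + t ^ 2)) / 2)). nra.
    + apply exp_monotone.
      assert (H1 := pow2_ge_0 (x - 1)). assert (H2 := pow2_ge_0 (x * t)).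
      nra. }
apply is_lim_ext_loc with (fun x => sqrt (PI / 2 - 2 * RInt (k x) 0 1)).
- exists 0. intros x Hx.
  rewrite <- (gauss_square_const x). fold (k x).
  replace (_ - _) with (RInt gauss 0 x ^ 2) by (unfold k; ring).
  apply sqrt_pow2. apply RInt_ge_0.
  + lra.
  + apply @ex_RInt_continuous. intros; apply continuous_gauss.
  + intros y _. apply Rlt_le, exp_pos.
- apply (filterlim_comp _ _ _ (fun x => PI / 2 - 2 * RInt (k x) 0 1) sqrt
    (Rbar_locally p_infty) (locally (PI / 2)) (locally (sqrt (PI / 2)))).
  + assert (L' : is_lim (fun x => PI / 2 - 2 * RInt (k x) 0 1) p_infty
      (PI / 2 - 2 * 0)).
    { apply is_lim_minus with (PI / 2) (2 * 0).
      - apply is_lim_const.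
      - exact (is_lim_scal_l (fun x => RInt (k x) 0 1) 2 p_infty 0 L).
      - reflexivity. }
    rewrite Rmult_0_r, Rminus_0_r in L'. exact L'.
  + apply continuous_sqrt.
Qed.

(** By [cosh^2 = 1 + sinh^2] the integrand is [gauss r] times the derivative
    of [x |-> int_0^(r sinh x) gauss]. *)
Lemma T0_phi_initial (r : R) :
  0 < r -> T 0 phi 0 r = sqrt (PI / 2) * gauss r.
Proof.
intros Hr. apply (is_RInt_gen_unique (V := R_CompleteNormedModule)).
set (G := fun x => gauss r * RInt gauss 0 (r * sinh x)).
replace (sqrt (PI / 2) * gauss r) with (gauss r * sqrt (PI / 2) - G 0).
2:{ unfold G. rewrite sinh_0, Rmult_0_r, RInt_point. unfold zero; simpl. ring. }
assert (D1 : forall y, is_derive (RInt gauss 0) y (gauss y)).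
{ intros y. apply (is_derive_RInt gauss (RInt gauss 0) 0 y).
  - apply filter_forall. intros z. apply (RInt_correct gauss).
    apply @ex_RInt_continuous. intros; apply continuous_gauss.
  - apply continuous_gauss. }
apply is_half_integral_primitive.
- intros x.
  replace (phi (r * cosh x - 0) * cosh x ^ 0) with
    (gauss r * ((r * cosh x) * gauss (r * sinh x))).
  2:{ rewrite pow_O, Rmult_1_r, Rminus_0_r. unfold phi, gauss.
      replace (- (r * cosh x) ^ 2 / 2) with
        (- r ^ 2 / 2 + - (r * sinh x) ^ 2 / 2).
      2:{ rewrite !Rpow_mult_distr, cosh2_sinh2. field. }
      rewrite exp_plus. ring. }
  apply is_derive_scal.
  apply (is_derive_comp (RInt gauss 0) (fun x => r * sinh x)).
  + apply D1.
  + apply is_derive_scal, is_derive_sinh.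
- intros x. apply continuous_T_integrand, continuous_phi.
- apply (is_lim_scal_l (fun x => RInt gauss 0 (r * sinh x)) (gauss r) p_infty
    (sqrt (PI / 2))).
  intros P HP. specialize (gauss_integral P HP). intros [M HM].
  exists (arcsinh (M / r)). intros x Hx. apply HM.
  apply Rmult_lt_reg_r with (/ r); [now apply Rinv_0_lt_compat|].
  replace (r * sinh x * / r) with (sinh x) by (field; lra).
  rewrite <- (sinh_arcsinh (M * / r)). apply sinh_lt. exact Hx.
Qed.

(** * Uniqueness for the radial wave system *)

Lemma continuity_2d_slice (f : R -> R -> R) (x y : R) :
  continuity_2d_pt f x y -> continuous (f x) y.
Proof.
intros H. apply filterlim_locally. intros eps.
destruct (H eps) as [d Hd]. exists d. intros z Hz. apply Hd; [|exact Hz].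
rewrite Rminus_diag, Rabs_R0. apply cond_pos.
Qed.

Lemma locally_pos (x : R) : 0 < x -> locally x (fun y => 0 < y).
Proof.
intros Hx. exists (mkposreal x Hx). intros y Hy.
apply Rabs_lt_between' in Hy. simpl in Hy. lra.
Qed.

Lemma locally_2d_pos (t r : R) :
  0 < t -> 0 < r -> locally_2d (fun u v => 0 < u /\ 0 < v) t r.
Proof.
intros Ht Hr. assert (Hm : 0 < Rmin t r) by now apply Rmin_pos.
exists (mkposreal _ Hm). intros u v Hu Hv. simpl in Hu, Hv.
assert (H1 := Rmin_l t r). assert (H2 := Rmin_r t r).
apply Rabs_lt_between' in Hu. apply Rabs_lt_between' in Hv. lra.
Qed.

(** The primitive of [f] is monotone and vanishes at both ends, so it is
    locally constant at [x] and its derivative [f x] is [0]. *)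
Lemma RInt_nonneg_eq_0 (f : R -> R) (a b x : R) :
  a < x < b -> (forall y, a <= y <= b -> continuous f y) ->
  (forall y, a <= y <= b -> 0 <= f y) -> RInt f a b <= 0 -> f x = 0.
Proof.
intros Hx Hc Hp H0.
assert (Hex : forall u v, a <= u -> u <= v -> v <= b -> ex_RInt f u v).
{ intros u v H1 H2 H3. apply @ex_RInt_continuous. intros z Hz. apply Hc.
  rewrite Rmin_left, Rmax_right in Hz; lra. }
assert (Hnn : forall u v, a <= u -> u <= v -> v <= b -> 0 <= RInt f u v).
{ intros u v H1 H2 H3. apply RInt_ge_0; auto. intros z Hz. apply Hp. lra. }
assert (Hloc : locally x (fun y => a < y < b)).
{ assert (Hm : 0 < Rmin (x - a) (b - x)) by (apply Rmin_pos; lra).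
  exists (mkposreal _ Hm). intros y Hy. apply Rabs_lt_between' in Hy.
  simpl in Hy.
  assert (H1 := Rmin_l (x - a) (b - x)). assert (H2 := Rmin_r (x - a) (b - x)).
  lra. }
assert (Hz : forall y, a < y < b -> RInt f a y = 0).
{ intros y Hy.
  assert (E : RInt f a y + RInt f y b = RInt f a b).
  { apply (RInt_Chasles f a y b); apply Hex; lra. }
  assert (H1 := Hnn a y). assert (H2 := Hnn y b). lra. }
assert (D : is_derive (RInt f a) x (f x)).
{ apply (is_derive_RInt f (RInt f a) a x).
  - generalize Hloc. apply filter_imp. intros y Hy.
    apply (RInt_correct f). apply Hex; lra.
  - apply Hc. lra. }
rewrite <- (is_derive_unique _ _ _ D).
rewrite (Derive_ext_loc (RInt f a) (fun _ => 0)).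
- apply Derive_const.
- generalize Hloc. apply filter_imp. exact Hz.
Qed.

(** The first-order form of the radial wave equation, for [w1 = W_t] and
    [w2 = W_r].  The same [w1r] serves as [r]-derivative of [w1] and as
    [t]-derivative of [w2]; this is the compatibility [W_tr = W_rt]. *)
Record radial_pair (w1 w2 w1t w1r w2r : R -> R -> R) : Prop := {
  rp_w1t : forall t r, 0 < t -> 0 < r -> is_derive (fun s => w1 s r) t (w1t t r);
  rp_w1r : forall t r, 0 < t -> 0 < r -> is_derive (fun q => w1 t q) r (w1r t r);
  rp_w2t : forall t r, 0 < t -> 0 < r -> is_derive (fun s => w2 s r) t (w1r t r);
  rp_w2r : forall t r, 0 < t -> 0 < r -> is_derive (fun q => w2 t q) r (w2r t r);
  rp_eq : forall t r, 0 < t -> 0 < r -> w1t t r = w2r t r + w2 t r / r;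
  rp_cont_t : forall t r, 0 < t -> 0 < r -> continuity_2d_pt w1t t r;
  rp_cont_r : forall t r, 0 < t -> 0 < r -> continuity_2d_pt w1r t r
}.

Section Energy.

Variables P Q Pt Pr Qr : R -> R -> R.

Hypothesis Hpair : radial_pair P Q Pt Pr Qr.
(* The absolute value extends the fields evenly to negative times, which turns
   continuity up to [t = 0] into continuity on a full neighbourhood. *)
Hypothesis CP : forall t r, 0 < r ->
  continuity_2d_pt (fun t r => P (Rabs t) r) t r.
Hypothesis CQ : forall t r, 0 < r ->
  continuity_2d_pt (fun t r => Q (Rabs t) r) t r.
Hypothesis HP0 : forall r, 0 < r -> P 0 r = 0.
Hypothesis HQ0 : forall r, 0 < r -> Q 0 r = 0.
(* The only condition at the axis: no energy enters through [r = 0]. *)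
Hypothesis Hflux : forall t0 eps, 0 < t0 -> 0 < eps ->
  exists rho, 0 < rho /\ forall t r, 0 < t <= t0 -> 0 < r <= rho ->
    r * Rabs (P t r * Q t r) <= eps.

Let HPt := rp_w1t _ _ _ _ _ Hpair.
Let HPr := rp_w1r _ _ _ _ _ Hpair.
Let HQt := rp_w2t _ _ _ _ _ Hpair.
Let HQr := rp_w2r _ _ _ _ _ Hpair.
Let Heq := rp_eq _ _ _ _ _ Hpair.
Let CPt := rp_cont_t _ _ _ _ _ Hpair.
Let CPr := rp_cont_r _ _ _ _ _ Hpair.

(* Twice the energy density, with the weight [r] of the planar area, and its
   time derivative. *)
Let e t r := r * (P t r ^ 2 + Q t r ^ 2).
Let et t r := 2 * (r * (P t r * Pt t r + Q t r * Pr t r)).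

Lemma energy_cont_pos (F : R -> R -> R) (t r : R) :
  (forall t r, 0 < r -> continuity_2d_pt (fun t r => F (Rabs t) r) t r) ->
  0 < t -> 0 < r -> continuity_2d_pt F t r.
Proof.
intros H Ht Hr. apply continuity_2d_pt_ext_loc with (2 := H t r Hr).
apply locally_2d_impl with (2 := locally_2d_pos t r Ht Hr).
apply locally_2d_forall. intros u v [Hu _]. now rewrite Rabs_pos_eq by lra.
Qed.

Lemma energy_cont_abs (t r : R) :
  0 < r -> continuity_2d_pt (fun t r => e (Rabs t) r) t r.
Proof.
intros Hr. unfold e.
apply continuity_2d_pt_ext with (fun t r =>
  r * (P (Rabs t) r * P (Rabs t) r + Q (Rabs t) r * Q (Rabs t) r)).
{ intros u v. ring. }
apply continuity_2d_pt_mult; [apply continuity_2d_pt_id2|].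
apply continuity_2d_pt_plus; apply continuity_2d_pt_mult; auto.
Qed.

Lemma energy_density_ge_0 (t r : R) : 0 <= r -> 0 <= e t r.
Proof.
intros Hr. unfold e. assert (H1 := pow2_ge_0 (P t r)).
assert (H2 := pow2_ge_0 (Q t r)). nra.
Qed.

Lemma energy_density_cont (t r : R) : 0 <= t -> 0 < r -> continuous (e t) r.
Proof.
intros Ht Hr. assert (C := continuity_2d_slice _ t r (energy_cont_abs t r Hr)).
simpl in C. rewrite Rabs_pos_eq in C by exact Ht. exact C.
Qed.

Lemma energy_density_ex_RInt (t a b : R) :
  0 <= t -> 0 < a -> 0 < b -> ex_RInt (e t) a b.
Proof.
intros Ht Ha Hb. apply @ex_RInt_continuous. intros r Hr.
apply energy_density_cont; [exact Ht|]. revert Hr.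
unfold Rmin. destruct (Rle_dec a b); lra.
Qed.

Lemma energy_density_derive (t r : R) :
  0 < t -> 0 < r -> is_derive (fun s => e s r) t (et t r).
Proof.
intros Ht Hr. unfold e, et. auto_derive.
- split; [now exists (Pt t r); apply HPt|].
  split; [now exists (Pr t r); apply HQt|exact I].
- replace (Derive (fun x => P x r) t) with (Pt t r)
    by (symmetry; now apply is_derive_unique, HPt).
  replace (Derive (fun x => Q x r) t) with (Pr t r)
    by (symmetry; now apply is_derive_unique, HQt). ring.
Qed.

Lemma energy_et_cont (t r : R) : 0 < t -> 0 < r -> continuity_2d_pt et t r.
Proof.
intros Ht Hr. unfold et.
apply continuity_2d_pt_mult; [apply continuity_2d_pt_const|].
apply continuity_2d_pt_mult; [apply continuity_2d_pt_id2|].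
apply continuity_2d_pt_plus; apply continuity_2d_pt_mult; auto using energy_cont_pos.
Qed.

Lemma energy_Derive_cont (t r : R) :
  0 < t -> 0 < r ->
  continuity_2d_pt (fun u v => Derive (fun z => e z v) u) t r.
Proof.
intros Ht Hr. apply continuity_2d_pt_ext_loc with (2 := energy_et_cont t r Ht Hr).
apply locally_2d_impl with (2 := locally_2d_pos t r Ht Hr).
apply locally_2d_forall. intros u v [Hu Hv].
symmetry. now apply is_derive_unique, energy_density_derive.
Qed.

(** By the system, [d/dt (r (P^2 + Q^2)) = d/dr (2 r P Q)]. *)
Lemma energy_flux (t a b : R) :
  0 < t -> 0 < a -> 0 < b ->
  RInt (fun r => Derive (fun s => e s r) t) a b =
  2 * (b * (P t b * Q t b)) - 2 * (a * (P t a * Q t a)).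
Proof.
intros Ht Ha Hb.
assert (Hpos : forall r, Rmin a b <= r <= Rmax a b -> 0 < r).
{ intros r. unfold Rmin. destruct (Rle_dec a b); lra. }
rewrite (RInt_ext _ (et t)).
2:{ intros r Hr. apply is_derive_unique, energy_density_derive; [exact Ht|].
    apply Hpos. lra. }
apply is_RInt_unique.
apply (is_RInt_derive (V := R_CompleteNormedModule)
  (fun r => 2 * (r * (P t r * Q t r)))).
- intros r Hr. specialize (Hpos r Hr). unfold et. auto_derive.
  + split; [now exists (Pr t r); apply HPr|].
    split; [now exists (Qr t r); apply HQr|exact I].
  + replace (Derive (fun x => P t x) r) with (Pr t r)
      by (symmetry; now apply is_derive_unique, HPr).
    replace (Derive (fun x => Q t x) r) with (Qr t r)
      by (symmetry; now apply is_derive_unique, HQr).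
    rewrite Heq by assumption. field. lra.
- intros r Hr. apply continuity_2d_slice, energy_et_cont; auto.
Qed.

Lemma energy_derive (R0 a t : R) :
  0 < t -> 0 < a -> 0 < R0 - t ->
  is_derive (fun s => RInt (e s) a (R0 - s)) t
    (2 * ((R0 - t) * (P t (R0 - t) * Q t (R0 - t))) -
     2 * (a * (P t a * Q t a)) - e t (R0 - t)).
Proof.
intros Ht Ha Hb.
rewrite <- energy_flux by assumption.
match goal with |- is_derive _ _ (?u - ?v) =>
  replace (u - v) with (u + v * -1) by ring end.
assert (Hb2 : 0 < (R0 - t) / 2) by lra.
apply (is_derive_RInt_param_bound_comp_aux3 e a (fun s => R0 - s)).
- generalize (locally_pos t Ht). apply filter_imp. intros s Hs.
  apply energy_density_ex_RInt; lra.
- exists (mkposreal _ Hb2). simpl.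
  generalize (locally_pos t Ht). apply filter_imp. intros s Hs.
  apply energy_density_ex_RInt; lra.
- auto_derive; [exact I|ring].
- exists (mkposreal _ Hb2). simpl.
  generalize (locally_pos t Ht). apply filter_imp. intros s Hs r Hr.
  exists (et s r). apply energy_density_derive; [exact Hs|].
  revert Hr. unfold Rmin. destruct (Rle_dec a (R0 - t - (R0 - t) / 2)); lra.
- intros r Hr. apply energy_Derive_cont; [exact Ht|].
  revert Hr. unfold Rmin. destruct (Rle_dec a (R0 - t)); lra.
- apply locally_2d_impl with (2 := locally_2d_pos t (R0 - t) Ht Hb).
  apply locally_2d_forall. intros u v [Hu Hv]. now apply energy_Derive_cont.
- apply continuity_pt_filterlim. apply energy_density_cont; lra.
Qed.

(** At the outer end [b = R0 - u] the flux [2 b P Q] is dominated by the loss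
    [b (P^2 + Q^2)] due to the shrinking interval, so only the inner flux
    remains. *)
Lemma energy_growth (R0 a s t m : R) :
  0 < s <= t -> 0 < a -> 0 < R0 - t ->
  (forall u, s <= u <= t -> a * Rabs (P u a * Q u a) <= m) ->
  RInt (e t) a (R0 - t) <= RInt (e s) a (R0 - s) + 2 * m * (t - s).
Proof.
intros Hst Ha Hb Hm.
destruct (MVT_gen (fun s => RInt (e s) a (R0 - s)) s t
  (fun t => 2 * ((R0 - t) * (P t (R0 - t) * Q t (R0 - t))) -
     2 * (a * (P t a * Q t a)) - e t (R0 - t))) as (c & Hc & E);
  rewrite ?Rmin_left, ?Rmax_right in * by lra.
- intros x Hx. apply energy_derive; lra.
- intros x Hx. apply ex_derive_continuity_pt. eexists.
  apply energy_derive; lra.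
- specialize (Hm c Hc).
  assert (H1 := Rle_abs (- (P c a * Q c a))). rewrite Rabs_Ropp in H1.
  assert (H2 := pow2_ge_0 (P c (R0 - c) - Q c (R0 - c))).
  assert (H3 : 0 < R0 - c) by lra.
  assert (H4 : 2 * ((R0 - c) * (P c (R0 - c) * Q c (R0 - c))) -
     2 * (a * (P c a * Q c a)) - e c (R0 - c) <= 2 * m).
  { unfold e. set (p := P c (R0 - c)) in *. set (q := Q c (R0 - c)) in *.
    assert (H5 : a * - (P c a * Q c a) <= a * Rabs (P c a * Q c a)).
    { apply Rmult_le_compat_l; lra. }
    nra. }
  assert (H5 := Rmult_le_compat_r (t - s) _ _ ltac:(lra) H4). lra.
Qed.

(** The density vanishes at [t = 0] and is uniformly continuous on
    [[0, t0] x [a, R0]]. *)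
Lemma energy_initial (R0 a t0 eps : R) :
  0 < a -> 0 < t0 -> a < R0 - t0 -> 0 < eps ->
  exists s, 0 < s <= t0 /\ RInt (e s) a (R0 - s) <= eps.
Proof.
intros Ha Ht Hb He.
assert (HR : 0 < R0) by lra.
destruct (uniform_continuity_2d (fun t r => e (Rabs t) r) 0 t0 a R0
  (fun x y _ Hy => energy_cont_abs x y (Rlt_le_trans _ _ _ Ha (proj1 Hy)))
  (mkposreal _ (Rdiv_lt_0_compat _ _ He HR))) as [d Hd].
simpl in Hd.
assert (Hd0 := cond_pos d).
exists (Rmin t0 (d / 2)).
assert (Hs0 : 0 < Rmin t0 (d / 2)) by (apply Rmin_pos; lra).
assert (Hs1 := Rmin_l t0 (d / 2)). assert (Hs2 := Rmin_r t0 (d / 2)).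
set (s := Rmin t0 (d / 2)) in *.
split; [lra|].
apply Rle_trans with ((R0 - s - a) * (eps / R0)).
- apply Rle_trans with (1 := Rle_abs _). apply abs_RInt_le_const.
  + lra.
  + apply energy_density_ex_RInt; lra.
  + intros r Hr. specialize (Hd 0 r s r).
    rewrite Rabs_R0, (Rabs_pos_eq s) in Hd by lra.
    replace (e 0 r) with 0 in Hd.
    2:{ unfold e. rewrite HP0, HQ0 by lra. ring. }
    rewrite !Rminus_0_r in Hd. apply Rlt_le, Hd; try lra.
    * rewrite Rabs_pos_eq; lra.
    * rewrite Rminus_diag, Rabs_R0. exact Hd0.
- apply Rle_trans with (R0 * (eps / R0)).
  + apply Rmult_le_compat_r; [|lra]. apply Rlt_le, Rdiv_lt_0_compat; lra.
  + apply Req_le. field. lra.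
Qed.

(** For [a] and [s] small the energy on [[a, R0 - t]] is at most [eps]; a
    fortiori on the fixed smaller interval [[r / 2, R0 - t]], whose interior
    contains [r]. *)
Theorem radial_wave_uniqueness (t r : R) :
  0 < t -> 0 < r -> P t r = 0 /\ Q t r = 0.
Proof.
intros Ht Hr.
(* Any [R0 > t + r] keeps [r] inside the interval that is left at time [t]. *)
set (R0 := t + r + 1).
assert (E0 : RInt (e t) (r / 2) (R0 - t) <= 0).
{ apply le_epsilon. intros eps He. rewrite Rplus_0_l.
  destruct (Hflux t (eps / (4 * t)) Ht) as (rho & Hrho & HF).
  { apply Rdiv_lt_0_compat; lra. }
  set (a := Rmin rho (r / 2)).
  assert (Ha : 0 < a) by (apply Rmin_pos; lra).
  assert (Ha1 : a <= rho) by apply Rmin_l.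
  assert (Ha2 : a <= r / 2) by apply Rmin_r.
  destruct (energy_initial R0 a t (eps / 2)) as (s & Hs & Hs');
    [lra|lra|unfold R0; lra|lra|].
  assert (G := energy_growth R0 a s t (eps / (4 * t)) Hs Ha).
  assert (G' : RInt (e t) a (R0 - t) <=
    RInt (e s) a (R0 - s) + 2 * (eps / (4 * t)) * (t - s)).
  { apply G; [unfold R0; lra|]. intros u Hu. apply HF; lra. }
  assert (C : RInt (e t) a (r / 2) + RInt (e t) (r / 2) (R0 - t) =
    RInt (e t) a (R0 - t)).
  { apply (RInt_Chasles (e t)); apply energy_density_ex_RInt;
      unfold R0; lra. }
  assert (N : 0 <= RInt (e t) a (r / 2)).
  { apply RInt_ge_0; [exact Ha2|apply energy_density_ex_RInt; lra|].
    intros x Hx. apply energy_density_ge_0. lra. }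
  assert (B : 2 * (eps / (4 * t)) * (t - s) <= eps / 2).
  { apply Rle_trans with (2 * (eps / (4 * t)) * t).
    - apply Rmult_le_compat_l; [|lra].
      assert (H := Rdiv_lt_0_compat eps (4 * t) He). lra.
    - apply Req_le. field. lra. }
  lra. }
assert (Z : e t r = 0).
{ apply (RInt_nonneg_eq_0 (e t) (r / 2) (R0 - t)).
  - unfold R0. lra.
  - intros y Hy. apply energy_density_cont; lra.
  - intros y Hy. apply energy_density_ge_0. lra.
  - exact E0. }
unfold e in Z. apply Rmult_integral in Z.
assert (H1 := pow2_ge_0 (P t r)). assert (H2 := pow2_ge_0 (Q t r)).
split; apply Rsqr_0_uniq; rewrite Rsqr_pow2; lra.
Qed.

End Energy.

(** * The wave potential and the integral representation *)

Lemma continuity_2d_pt_comp_l (f : R -> R -> R) (k : R -> R) (t r : R) :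
  continuity_pt k t -> continuity_2d_pt f (k t) r ->
  continuity_2d_pt (fun t r => f (k t) r) t r.
Proof.
intros Hk Hf eps. destruct (Hf eps) as [d Hd].
apply continuity_pt_filterlim in Hk.
assert (Hk' := proj1 (filterlim_locally k (k t)) Hk d).
destruct Hk' as [d' Hd'].
assert (Hm : 0 < Rmin d d') by (apply Rmin_pos; apply cond_pos).
exists (mkposreal _ Hm). intros u v Hu Hv. simpl in Hu, Hv. apply Hd.
- apply Hd'. apply Rlt_le_trans with (1 := Hu), Rmin_r.
- apply Rlt_le_trans with (1 := Hv), Rmin_l.
Qed.

(** Space-time continuity restricted to the points [(k t, (r, 0))].  The map
    [k] is the identity for open time domains and [Rabs] for closed ones. *)
Lemma continuous_st_axis (T : R -> Prop) (f : R -> R -> R -> R) (k : R -> R)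
  (t r : R) :
  continuous_st T f -> continuity_pt k t -> T (k t) ->
  locally t (fun s => T (k s)) ->
  continuity_2d_pt (fun t r => f (k t) r 0) t r.
Proof.
intros Hf Hk Ht Hloc eps.
assert (H := proj1 (filterlim_locally _ _) (Hf (k t, (r, 0)) Ht) eps).
destruct H as [d Hd]. simpl in Hd.
apply continuity_pt_filterlim in Hk.
destruct (proj1 (filterlim_locally k (k t)) Hk d) as [d1 Hd1].
destruct Hloc as [d2 Hd2].
assert (Hm : 0 < Rmin d (Rmin d1 d2)).
{ repeat apply Rmin_pos; apply cond_pos. }
exists (mkposreal _ Hm). intros u v Hu Hv. simpl in Hu, Hv.
assert (M1 := Rmin_l d (Rmin d1 d2)). assert (M2 := Rmin_r d (Rmin d1 d2)).
assert (M3 := Rmin_l d1 d2). assert (M4 := Rmin_r d1 d2).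
apply (Hd (k u, (v, 0))).
- split; [|split]; simpl.
  + apply Hd1. change (Rabs (u - t) < d1). lra.
  + change (Rabs (v - r) < d). lra.
  + apply ball_center.
- apply Hd2. change (Rabs (u - t) < d2). lra.
Qed.

(** [f t r] is uniformly close to [f t 0], and [t |-> f t 0] is bounded on the
    segment. *)
Lemma bounded_near_axis (f : R -> R -> R) (t0 : R) :
  (forall t r, continuity_2d_pt f t r) -> 0 < t0 ->
  exists M rho, 0 <= M /\ 0 < rho /\
    forall t r, 0 <= t <= t0 -> 0 <= r <= rho -> Rabs (f t r) <= M.
Proof.
intros Hf Ht0.
destruct (uniform_continuity_2d f 0 t0 0 1 (fun x y _ _ => Hf x y)
  (mkposreal 1 Rlt_0_1)) as [d Hd]. simpl in Hd.
destruct (continuity_ab_maj (fun t => Rabs (f t 0)) 0 t0) as (tm & Hm & _).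
- lra.
- intros t _. apply (continuity_pt_comp (fun t => f t 0) Rabs).
  + intros eps He. destruct (Hf t 0 (mkposreal eps He)) as [d' Hd'].
    exists d'. split; [apply cond_pos|]. intros x [_ Hx].
    apply Hd'; [exact Hx|]. rewrite Rminus_diag, Rabs_R0. apply cond_pos.
  + apply Rcontinuity_abs.
- exists (Rabs (f tm 0) + 1), (Rmin 1 (d / 2)).
  assert (Hd0 := cond_pos d).
  split; [assert (H := Rabs_pos (f tm 0)); lra|].
  split; [apply Rmin_pos; lra|].
  intros t r Ht Hr.
  assert (M1 := Rmin_l 1 (d / 2)). assert (M2 := Rmin_r 1 (d / 2)).
  assert (H1 : Rabs (f t r - f t 0) < 1).
  { apply Hd; try lra.
    - rewrite Rminus_diag, Rabs_R0. exact Hd0.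
    - rewrite Rminus_0_r, Rabs_pos_eq; lra. }
  specialize (Hm t Ht).
  replace (f t r) with ((f t r - f t 0) + f t 0) by ring.
  apply Rle_trans with (1 := Rabs_triang _ _). lra.
Qed.

(** The fields of [W] are read off along the positive half of the [x]-axis,
    where [u_x = W_r].  Equality of the mixed derivatives is Schwarz's theorem;
    the equation [W_tt = W_rr + W_r / r] comes from
    [wave_potential_radial], whose derivatives are identified with those of
    the space-time solution to inherit their continuity. *)
Lemma wave_potential_pair (W : R -> R -> R) :
  wave_potential W ->
  exists w1 w2 w1t w1r w2r,
    (forall t r, 0 <= t -> 0 < r ->
       is_derive_within (fun s => 0 <= s) (fun s => W s r) t (w1 t r) /\
       is_derive (fun q => W t q) r (w2 t r)) /\
    radial_pair w1 w2 w1t w1r w2r /\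
    (forall t r, continuity_2d_pt (fun t r => w1 (Rabs t) r) t r) /\
    (forall t r, continuity_2d_pt (fun t r => w2 (Rabs t) r) t r) /\
    (forall r, 0 < r -> w1 0 r = - gauss r) /\
    (forall r, 0 < r -> w2 0 r = 0).
Proof.
intros HW. assert (Rad := wave_potential_radial W HW).
destruct HW as (ut & ux & uy & HC1 & HC2 & Hg & Hh).
destruct HC2 as (utt & utx & uty & uxt & uxx & uxy & uyt & uyx & uyy
  & [Dt (_ & Ctt & Ctx & _)] & [Dx (_ & Cxt & _ & _)] & _ & _).
destruct HC1 as [D1 (_ & Ct & Cx & _)].
assert (S0 : forall r, 0 < r -> sqrt (r ^ 2 + 0 ^ 2) = r).
{ intros r Hr. replace (r ^ 2 + 0 ^ 2) with (r ^ 2) by ring.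
  apply sqrt_pow2; lra. }
assert (HWt : forall t r, 0 <= t -> 0 < r ->
  is_derive_within (fun s => 0 <= s) (fun s => W s r) t (ut t r 0)).
{ intros t r Ht Hr. destruct (D1 t r 0 Ht) as (H & _ & _).
  now rewrite S0 in H by exact Hr. }
assert (HWr : forall t r, 0 <= t -> 0 < r ->
  is_derive (fun q => W t q) r (ux t r 0)).
{ intros t r Ht Hr. destruct (D1 t r 0 Ht) as (_ & H & _).
  apply is_derive_ext_loc with (2 := H).
  generalize (locally_pos r Hr). apply filter_imp. intros z Hz.
  now rewrite S0. }
assert (HWt' : forall t r, 0 < t -> 0 < r ->
  is_derive (fun s => W s r) t (ut t r 0)).
{ intros t r Ht Hr. apply is_derive_within_open with (fun s => 0 <= s).
  - generalize (locally_pos t Ht). apply filter_imp. intros; lra.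
  - apply HWt; lra. }
assert (Dtt : forall t r, 0 < t -> is_derive (fun s => ut s r 0) t (utt t r 0)).
{ intros t r Ht. apply is_derive_within_open with (1 := locally_pos t Ht).
  now apply Dt. }
assert (Dxt : forall t r, 0 < t -> is_derive (fun s => ux s r 0) t (uxt t r 0)).
{ intros t r Ht. apply is_derive_within_open with (1 := locally_pos t Ht).
  now apply Dx. }
assert (Dtx : forall t r, 0 < t -> is_derive (fun q => ut t q 0) r (utx t r 0)).
{ intros t r Ht. now apply Dt. }
assert (Dxx : forall t r, 0 < t -> is_derive (fun q => ux t q 0) r (uxx t r 0)).
{ intros t r Ht. now apply Dx. }
assert (Cpos : forall f t r, continuous_st (fun t => 0 < t) f -> 0 < t ->
  continuity_2d_pt (fun t r => f t r 0) t r).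
{ intros f t r Hf Ht.
  apply (continuous_st_axis (fun t => 0 < t) f (fun t => t) t r Hf).
  - apply continuity_pt_id.
  - exact Ht.
  - now apply locally_pos. }
assert (Cabs : forall f t r, continuous_st (fun t => 0 <= t) f ->
  continuity_2d_pt (fun t r => f (Rabs t) r 0) t r).
{ intros f t r Hf.
  apply (continuous_st_axis (fun t => 0 <= t) f Rabs t r Hf).
  - apply Rcontinuity_abs.
  - apply Rabs_pos.
  - apply filter_forall. intros; apply Rabs_pos. }
assert (Hsym : forall t r, 0 < t -> 0 < r -> uxt t r 0 = utx t r 0).
{ intros t r Ht Hr.
  assert (Ex : forall t r, 0 < t -> 0 < r ->
    is_derive (fun z => Derive (fun q => W z q) r) t (uxt t r 0)).
  { clear t r Ht Hr. intros t r Ht Hr.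
    apply is_derive_ext_loc with (2 := Dxt t r Ht).
    generalize (locally_pos t Ht). apply filter_imp. intros z Hz.
    symmetry. apply is_derive_unique, HWr; lra. }
  assert (Et : forall t r, 0 < t -> 0 < r ->
    is_derive (fun z => Derive (fun s => W s z) t) r (utx t r 0)).
  { clear t r Ht Hr. intros t r Ht Hr.
    apply is_derive_ext_loc with (2 := Dtx t r Ht).
    generalize (locally_pos r Hr). apply filter_imp. intros z Hz.
    symmetry. now apply is_derive_unique, HWt'. }
  rewrite <- (is_derive_unique _ _ _ (Ex t r Ht Hr)).
  rewrite <- (is_derive_unique _ _ _ (Et t r Ht Hr)).
  apply (Schwarz W t r).
  - apply locally_2d_impl with (2 := locally_2d_pos t r Ht Hr).
    apply locally_2d_forall. intros u v [Hu Hv]. repeat split.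
    + now exists (ut u v 0); apply HWt'.
    + exists (ux u v 0). apply HWr; lra.
    + exists (uxt u v 0). now apply Ex.
    + exists (utx u v 0). now apply Et.
  - apply continuity_2d_pt_ext_loc with (2 := Cpos uxt t r Cxt Ht).
    apply locally_2d_impl with (2 := locally_2d_pos t r Ht Hr).
    apply locally_2d_forall. intros u v [Hu Hv].
    symmetry. now apply is_derive_unique, Ex.
  - apply continuity_2d_pt_ext_loc with (2 := Cpos utx t r Ctx Ht).
    apply locally_2d_impl with (2 := locally_2d_pos t r Ht Hr).
    apply locally_2d_forall. intros u v [Hu Hv].
    symmetry. now apply is_derive_unique, Et. }
exists (fun t r => ut t r 0), (fun t r => ux t r 0), (fun t r => utt t r 0),
  (fun t r => utx t r 0), (fun t r => uxx t r 0).
split; [now split; [apply HWt|apply HWr]|].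
split; [constructor|].
- intros t r Ht Hr. now apply Dtt.
- intros t r Ht Hr. now apply Dtx.
- intros t r Ht Hr. rewrite <- Hsym by assumption. now apply Dxt.
- intros t r Ht Hr. now apply Dxx.
- intros t r Ht Hr.
  (* [wave_potential_radial] states the equation with [(r W_r)_r]; expand it. *)
  destruct Rad as (Wt & Wr & R1 & R2 & _ & _).
  assert (E1 : forall t r, 0 < t -> 0 < r -> Wt t r = ut t r 0).
  { clear t r Ht Hr. intros t r Ht Hr.
    rewrite <- (is_derive_unique _ _ _ (HWt' t r Ht Hr)). symmetry.
    apply is_derive_unique. apply is_derive_within_open with (fun s => 0 <= s).
    - generalize (locally_pos t Ht). apply filter_imp. intros; lra.
    - apply R1; lra. }
  assert (E2 : forall t r, 0 < t -> 0 < r -> Wr t r = ux t r 0).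
  { clear t r Ht Hr. intros t r Ht Hr.
    rewrite <- (is_derive_unique _ _ _ (HWr t r (Rlt_le _ _ Ht) Hr)). symmetry.
    apply is_derive_unique. apply R1; lra. }
  destruct (R2 t r Ht Hr) as (Wtt & l & H1 & H2 & H3).
  assert (F1 : Wtt = utt t r 0).
  { rewrite <- (is_derive_unique _ _ _ H1).
    apply is_derive_unique, is_derive_ext_loc with (2 := Dtt t r Ht).
    generalize (locally_pos t Ht). apply filter_imp. intros z Hz.
    symmetry. now apply E1. }
  assert (F2 : l = ux t r 0 + r * uxx t r 0).
  { rewrite <- (is_derive_unique _ _ _ H2).
    apply is_derive_unique.
    apply is_derive_ext_loc with (fun q => q * ux t q 0).
    - generalize (locally_pos r Hr). apply filter_imp. intros z Hz.
      now rewrite E2.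
    - assert (D := is_derive_mult (fun q => q) (fun q => ux t q 0) r 1
        (uxx t r 0) (is_derive_id (K := R_AbsRing) r) (Dxx t r Ht) Rmult_comm).
      replace (ux t r 0 + r * uxx t r 0) with
        (plus (mult 1 (ux t r 0)) (mult r (uxx t r 0))); [exact D|].
      unfold plus, mult; simpl. ring. }
  rewrite F1, F2 in H3.
  replace (utt t r 0) with (/ r * (ux t r 0 + r * uxx t r 0)) by lra.
  field. lra.
- intros t r Ht Hr. now apply Cpos.
- intros t r Ht Hr. now apply Cpos.
- repeat split.
  + intros t r. now apply Cabs.
  + intros t r. now apply Cabs.
  + intros r Hr. rewrite Hh, S0 by exact Hr. reflexivity.
  + intros r Hr. rewrite <- (is_derive_unique _ _ _ (HWr 0 r (Rle_refl 0) Hr)).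
    rewrite (Derive_ext_loc _ (fun _ => 0)).
    * apply Derive_const.
    * generalize (locally_pos r Hr). apply filter_imp. intros z Hz.
      assert (H := Hg z 0). now rewrite S0 in H.
Qed.

Lemma radial_pair_minus (w1 w2 w1t w1r w2r v1 v2 v1t v1r v2r : R -> R -> R) :
  radial_pair w1 w2 w1t w1r w2r -> radial_pair v1 v2 v1t v1r v2r ->
  radial_pair (fun t r => w1 t r - v1 t r) (fun t r => w2 t r - v2 t r)
    (fun t r => w1t t r - v1t t r) (fun t r => w1r t r - v1r t r)
    (fun t r => w2r t r - v2r t r).
Proof.
intros [A1 A2 A3 A4 A5 A6 A7] [B1 B2 B3 B4 B5 B6 B7].
constructor; intros t r Ht Hr.
- apply (is_derive_minus (V := R_NormedModule)); auto.
- apply (is_derive_minus (V := R_NormedModule)); auto.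
- apply (is_derive_minus (V := R_NormedModule)); auto.
- apply (is_derive_minus (V := R_NormedModule)); auto.
- rewrite A5, B5 by assumption. field. lra.
- apply continuity_2d_pt_minus; auto.
- apply continuity_2d_pt_minus; auto.
Qed.

(** The even and odd parts in [t], up to a factor [2]. *)
Definition even_part (j : nat) (h : R -> R) (t r : R) : R :=
  T j h t r + T j h (- t) r.
Definition odd_part (j : nat) (h : R -> R) (t r : R) : R :=
  T j h t r - T j h (- t) r.

Lemma is_derive_T_neg (j : nat) (h h1 h2 : R -> R) (t r : R) :
  smooth_rapid h h1 h2 -> 0 < r ->
  is_derive (fun t => T j h (- t) r) t (T j h1 (- t) r).
Proof.
intros Hh Hr.
assert (D1 : is_derive Ropp t (-1)) by (auto_derive; [exact I|ring]).
assert (D := is_derive_comp (fun s => T j h s r) Ropp t _ _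
  (is_derive_T_s j h h1 h2 (- t) r Hh Hr) D1).
replace (T j h1 (- t) r) with (scal (-1) (- T j h1 (- t) r)); [exact D|].
unfold scal; simpl; unfold mult; simpl. ring.
Qed.

Lemma continuity_2d_T_neg (j : nat) (h h1 h2 : R -> R) (t r : R) :
  smooth_rapid h h1 h2 -> 0 < r ->
  continuity_2d_pt (fun t r => T j h (- t) r) t r.
Proof.
intros Hh Hr. apply (continuity_2d_pt_comp_l (T j h) Ropp).
- apply ex_derive_continuity_pt. auto_derive; exact I.
- now apply continuity_2d_T with h1 h2.
Qed.

Lemma T_radial_pair (c : R) :
  radial_pair
    (fun t r => - (c * even_part 0 phi t r)) (fun t r => c * odd_part 1 phi t r)
    (fun t r => c * odd_part 0 phi1 t r)
    (fun t r => - (c * even_part 1 phi1 t r))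
    (fun t r => c * odd_part 2 phi1 t r).
Proof.
unfold even_part, odd_part.
assert (S := smooth_rapid_phi). assert (S1 := smooth_rapid_phi1).
assert (DT := fun j t r Hr => is_derive_T_s j phi phi1 phi2 t r S Hr).
assert (DN := fun j t r Hr => is_derive_T_neg j phi phi1 phi2 t r S Hr).
assert (DR := fun j t r Hr => is_derive_T_r j phi phi1 phi2 t r S Hr).
constructor; intros t r Ht Hr.
- replace (c * (T 0 phi1 t r - T 0 phi1 (- t) r)) with
    (opp (c * plus (- T 0 phi1 t r) (T 0 phi1 (- t) r))).
  2:{ unfold opp, plus; simpl. ring. }
  apply (is_derive_opp (V := R_NormedModule)), is_derive_scal.
  apply (is_derive_plus (V := R_NormedModule)); auto.
- apply (is_derive_opp (V := R_NormedModule)), is_derive_scal.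
  apply (is_derive_plus (V := R_NormedModule)); auto.
- replace (- (c * (T 1 phi1 t r + T 1 phi1 (- t) r))) with
    (c * minus (- T 1 phi1 t r) (T 1 phi1 (- t) r)).
  2:{ unfold minus, opp, plus; simpl. ring. }
  apply is_derive_scal, (is_derive_minus (V := R_NormedModule)); auto.
- apply is_derive_scal, (is_derive_minus (V := R_NormedModule)); auto.
- assert (E1 := T_phi_identity t r Hr). assert (E2 := T_phi_identity (- t) r Hr).
  apply Rmult_eq_reg_l with r; [|lra].
  replace (r * (c * (T 2 phi1 t r - T 2 phi1 (- t) r) +
    c * (T 1 phi t r - T 1 phi (- t) r) / r)) with
    (c * ((r * (T 2 phi1 t r - T 0 phi1 t r) + T 1 phi t r) -
          (r * (T 2 phi1 (- t) r - T 0 phi1 (- t) r) + T 1 phi (- t) r)) +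
     r * (c * (T 0 phi1 t r - T 0 phi1 (- t) r))) by (field; lra).
  rewrite E1, E2. ring.
- apply continuity_2d_pt_mult; [apply continuity_2d_pt_const|].
  apply continuity_2d_pt_minus.
  + now apply continuity_2d_T with phi2 phi3.
  + now apply continuity_2d_T_neg with phi2 phi3.
- apply continuity_2d_pt_opp.
  apply continuity_2d_pt_mult; [apply continuity_2d_pt_const|].
  apply continuity_2d_pt_plus.
  + now apply continuity_2d_T with phi2 phi3.
  + now apply continuity_2d_T_neg with phi2 phi3.
Qed.

(** [r |P Q| <= (r M1 + sqrt (B r)) M2 = O (sqrt r)]. *)
Lemma flux_vanishes (P Q : R -> R -> R) (M1 M2 B rho1 t0 eps : R) :
  0 <= M1 -> 0 <= M2 -> 0 <= B -> 0 < rho1 -> 0 < eps ->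
  (forall t r, 0 < t <= t0 -> 0 < r <= rho1 ->
     Rabs (P t r) <= M1 + sqrt (B / r) /\ Rabs (Q t r) <= M2) ->
  exists rho, 0 < rho /\ forall t r, 0 < t <= t0 -> 0 < r <= rho ->
    r * Rabs (P t r * Q t r) <= eps.
Proof.
intros HM1 HM2 HB Hrho1 He HPQ.
assert (HsB := sqrt_pos B).
(* For [r <= 1], [r <= sqrt r] and the flux is at most [D sqrt r]; the [+ 1]
   makes [D] invertible. *)
set (D := (M1 + sqrt B) * M2 + 1).
assert (HD : 0 < D) by (unfold D; nra).
assert (HeD : 0 < eps / D) by now apply Rdiv_lt_0_compat.
exists (Rmin (Rmin 1 rho1) ((eps / D) ^ 2)). split.
{ repeat apply Rmin_pos; try lra. now apply pow_lt. }
intros t r Ht [Hr Hr'].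
assert (H1 := Rle_trans _ _ _ Hr' (Rmin_l _ _)).
assert (H2 := Rle_trans _ _ _ Hr' (Rmin_r _ _)).
assert (H3 := Rle_trans _ _ _ H1 (Rmin_l _ _)).
assert (H4 := Rle_trans _ _ _ H1 (Rmin_r _ _)).
destruct (HPQ t r Ht (conj Hr H4)) as [HP HQ].
assert (Hs : 0 < sqrt r) by now apply sqrt_lt_R0.
assert (Hss : sqrt r * sqrt r = r) by (apply sqrt_sqrt; lra).
assert (Hs1 : sqrt r <= 1) by (rewrite <- sqrt_1; now apply sqrt_le_1_alt).
assert (Hse : sqrt r <= eps / D).
{ rewrite <- (sqrt_pow2 (eps / D)) by lra. now apply sqrt_le_1_alt. }
assert (HrP : r * Rabs (P t r) <= (M1 + sqrt B) * sqrt r).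
{ apply Rle_trans with (r * (M1 + sqrt (B / r))).
  - apply Rmult_le_compat_l; lra.
  - assert (E : r * sqrt (B / r) = sqrt B * sqrt r).
    { rewrite sqrt_div_alt by exact Hr. rewrite <- Hss at 1. field. lra. }
    assert (Hrs : r <= sqrt r) by (rewrite <- Hss at 1; nra).
    rewrite Rmult_plus_distr_l, Rmult_plus_distr_r, E.
    apply Rplus_le_compat_r. rewrite Rmult_comm.
    now apply Rmult_le_compat_l. }
rewrite Rabs_mult, <- Rmult_assoc.
apply Rle_trans with ((M1 + sqrt B) * sqrt r * M2).
- apply Rmult_le_compat; auto using Rabs_pos.
  apply Rmult_le_pos; [lra|apply Rabs_pos].
- apply Rle_trans with (D * sqrt r).
  + unfold D. nra.
  + apply Rle_trans with (D * (eps / D)).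
    * apply Rmult_le_compat_l; lra.
    * apply Req_le. field. lra.
Qed.

Lemma gauss_normalization : / sqrt (2 * PI) * sqrt (PI / 2) = / 2.
Proof.
assert (HP := PI_RGT_0).
replace (2 * PI) with (2 ^ 2 * (PI / 2)) by field.
rewrite sqrt_mult_alt, sqrt_pow2 by lra.
assert (H : 0 < sqrt (PI / 2)) by (apply sqrt_lt_R0; lra).
field. lra.
Qed.

(** Uniqueness applied to the difference of the two pairs of fields. *)
Lemma wave_fields_eq (w1 w2 w1t w1r w2r : R -> R -> R) :
  radial_pair w1 w2 w1t w1r w2r ->
  (forall t r, continuity_2d_pt (fun t r => w1 (Rabs t) r) t r) ->
  (forall t r, continuity_2d_pt (fun t r => w2 (Rabs t) r) t r) ->
  (forall r, 0 < r -> w1 0 r = - gauss r) ->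
  (forall r, 0 < r -> w2 0 r = 0) ->
  forall t r, 0 <= t -> 0 < r ->
    w1 t r = - (/ sqrt (2 * PI) * even_part 0 phi t r) /\
    w2 t r = / sqrt (2 * PI) * odd_part 1 phi t r.
Proof.
intros Hw C1 C2 Z1 Z2.
set (c := / sqrt (2 * PI)).
assert (Hc : 0 < c).
{ apply Rinv_0_lt_compat, sqrt_lt_R0. assert (H := PI_RGT_0). lra. }
assert (I1 : forall r, 0 < r ->
  w1 0 r - - (c * even_part 0 phi 0 r) = 0).
{ intros r Hr. unfold even_part.
  rewrite Z1, Ropp_0, T0_phi_initial by exact Hr.
  replace (c * (sqrt (PI / 2) * gauss r + sqrt (PI / 2) * gauss r)) with
    (2 * (c * sqrt (PI / 2)) * gauss r) by ring.
  unfold c. rewrite gauss_normalization. field. }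
assert (I2 : forall r, 0 < r -> w2 0 r - c * odd_part 1 phi 0 r = 0).
{ intros r Hr. unfold odd_part. rewrite Z2, Ropp_0 by exact Hr. ring. }
intros t r [Ht| <-] Hr.
2:{ split; apply Rminus_diag_uniq; auto. }
assert (CT : forall j t r, 0 < r ->
  continuity_2d_pt (fun t r => T j phi (Rabs t) r) t r /\
  continuity_2d_pt (fun t r => T j phi (- Rabs t) r) t r).
{ intros j t' r' Hr'. split.
  - apply (continuity_2d_pt_comp_l (T j phi) Rabs).
    + apply Rcontinuity_abs.
    + apply continuity_2d_T with phi1 phi2;
        [apply smooth_rapid_phi|exact Hr'].
  - apply (continuity_2d_pt_comp_l (fun t r => T j phi (- t) r) Rabs).
    + apply Rcontinuity_abs.
    + apply continuity_2d_T_neg with phi1 phi2;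
        [apply smooth_rapid_phi|exact Hr']. }
destruct (fun H1 H2 H3 => radial_wave_uniqueness _ _ _ _ _
  (radial_pair_minus _ _ _ _ _ _ _ _ _ _ Hw (T_radial_pair c))
  H1 H2 I1 I2 H3 t r Ht Hr) as [E1 E2].
- intros t' r' Hr'. destruct (CT 0%nat t' r' Hr') as [H1 H2].
  apply continuity_2d_pt_minus; [apply C1|].
  apply continuity_2d_pt_opp, continuity_2d_pt_mult;
    [apply continuity_2d_pt_const|].
  now apply continuity_2d_pt_plus.
- intros t' r' Hr'. destruct (CT 1%nat t' r' Hr') as [H1 H2].
  apply continuity_2d_pt_minus; [apply C2|].
  apply continuity_2d_pt_mult; [apply continuity_2d_pt_const|].
  now apply continuity_2d_pt_minus.
- intros t0 eps Ht0 He.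
  destruct (bounded_near_axis _ t0 C1 Ht0) as (M1 & d1 & HM1 & Hd1 & B1).
  destruct (bounded_near_axis _ t0 C2 Ht0) as (M2 & d2 & HM2 & Hd2 & B2).
  destruct (T0_phi_bound t0 (Rlt_le _ _ Ht0)) as (B & HB & BT).
  destruct T1_phi_diff_bounded as [K HK].
  assert (HK0 : 0 <= K).
  { apply Rle_trans with (2 := HK 0 1 Rlt_0_1), Rabs_pos. }
  apply flux_vanishes with (M1 := M1) (M2 := M2 + c * K)
    (B := (2 * c) ^ 2 * B) (rho1 := Rmin d1 d2).
  + exact HM1.
  + nra.
  + apply Rmult_le_pos; [apply pow2_ge_0|exact HB].
  + now apply Rmin_pos.
  + exact He.
  + intros s q Hs Hq.
    assert (N1 := Rmin_l d1 d2). assert (N2 := Rmin_r d1 d2).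
    specialize (B1 s q ltac:(lra) ltac:(lra)).
    specialize (B2 s q ltac:(lra) ltac:(lra)).
    simpl in B1, B2. rewrite (Rabs_pos_eq s) in B1, B2 by lra.
    assert (Hs' : Rabs s <= t0) by (rewrite Rabs_pos_eq; lra).
    assert (T1 := BT s q Hs' (proj1 Hq)).
    assert (T2 := BT (- s) q ltac:(now rewrite Rabs_Ropp) (proj1 Hq)).
    split.
    * unfold Rminus. rewrite Ropp_involutive.
      apply Rle_trans with (1 := Rabs_triang _ _).
      apply Rplus_le_compat; [exact B1|].
      replace ((2 * c) ^ 2 * B / q) with ((2 * c) ^ 2 * (B / q))
        by (field; lra).
      rewrite sqrt_mult_alt by apply pow2_ge_0. rewrite sqrt_pow2 by lra.
      unfold even_part. rewrite Rabs_mult, (Rabs_pos_eq c) by lra.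
      assert (T3 := Rabs_triang (T 0 phi s q) (T 0 phi (- s) q)).
      apply Rle_trans with (c * (sqrt (B / q) + sqrt (B / q))).
      -- apply Rmult_le_compat_l; lra.
      -- apply Req_le. ring.
    * unfold Rminus at 1. apply Rle_trans with (1 := Rabs_triang _ _).
      rewrite Rabs_Ropp, Rabs_mult, (Rabs_pos_eq c) by lra.
      apply Rplus_le_compat; [exact B2|].
      apply Rmult_le_compat_l; [lra|]. now apply HK.
- split; now apply Rminus_diag_uniq.
Qed.

Theorem lemma4 : forall W : R -> R -> R,
  wave_potential W ->
  (forall (j : nat) (s r : R), (j = 0%nat \/ j = 1%nat) -> 0 < r ->
     ex_RInt_gen (J_integrand j s r) (at_right 0) (Rbar_locally p_infty)) /\
  (forall t r : R, 0 <= t -> 0 < r ->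
     exists Wt Wr : R,
       is_derive_within (fun s => 0 <= s) (fun s => W s r) t Wt /\
       is_derive (fun q => W t q) r Wr /\
       - Wt = J 0 t r + J 0 (- t) r /\
       Wr = J 1 t r - J 1 (- t) r).
Proof.
intros W HW. split.
- intros j s r _ Hr. exists (T j phi s r). now apply is_RInt_gen_J.
- intros t r Ht Hr.
  destruct (wave_potential_pair W HW)
    as (w1 & w2 & w1t & w1r & w2r & D & Hw & C1 & C2 & Z1 & Z2).
  destruct (D t r Ht Hr) as [D1 D2].
  destruct (wave_fields_eq _ _ _ _ _ Hw C1 C2 Z1 Z2 t r Ht Hr) as [E1 E2].
  exists (w1 t r), (w2 t r). split; [exact D1|]. split; [exact D2|].
  rewrite E1, E2, !J_eq by exact Hr. unfold even_part, odd_part.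
  split; ring.
Qed.
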